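(* Consider the AE jigsaw percolation dynamics ($\sigma=\tau=1$, $\theta=\infty$) with $p=\mu/(D\log N)$ for a constant $\mu$, where $N$ is the number of vertices of $G_{\mathrm{puz}}$ and $D$ is its maximum degree (which may depend on $N$). For each of the following vertex-transitive puzzle graphs, there exists a universal constant $C$ such that $\mu\ge C$ implies $\mathbb{P}_p(\mathrm{Solve})\to 1$ as $N\to\infty$: (1) the $d$-dimensional torus $\mathbb{Z}_n^d$ with lattice edges; (2) the range-$r$ two-dimensional graph on $\mathbb{Z}_n^2$ with neighborhood of $x$ given by $\{y:\|x-y\|_\infty\le r\}$; (3) the hypercube with vertex set $\{0,1\}^n$; (4) the $d$-dimensional Hamming graph with vertex set $\mathbb{Z}_n^d$.
   Context: Setting. $G_{\mathrm{puz}}=(V,E_{\mathrm{puz}})$ (the puzzle graph) is a finite connected deterministic graph with $N=|V|$ vertices; one considers a sequence of such graphs with $N$ increasing with the integer parameter $n$. $G_{\mathrm{ppl}}=(V,E_{\mathrm{ppl}})$ (the people graph) is the Erdős–Rényi random graph on the same vertex set: each unordered pair of distinct vertices is an edge independently with probability $p$ (which may depend on $N$); $\mathbb{P}_p$ denotes its law. Two vertices $v_1,v_2$ are doubly connected if $\{v_1,v_2\}\in E_{\mathrm{ppl}}\cap E_{\mathrm{puz}}$. For $v\in V$, $S\subset V$, let $\mathrm{coll}(v,S)$ (resp. $\mathrm{link}(v,S)$) be the number of $G_{\mathrm{ppl}}$-neighbors (resp. $G_{\mathrm{puz}}$-neighbors) of $v$ in $S$, not including $v$. Jigsaw percolation with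 parameters $\sigma\ge1$, $\tau\ge1$, $\theta\ge\tau$ ($\theta=\infty$ allowed) is the following discrete-time dynamics on partitions $\mathcal{P}^t=\{W_i^t\}$ of $V$. Given $\mathcal{P}^t$, let $\mathcal{G}_t$ be the graph with vertex set $\mathcal{P}^t$ and unoriented edges between any distinct $W_i^t$ and $W_j^t$ such that, for some ordering of the two, at least one of the following holds: (J1) there are doubly connected vertices $v_1\in W_i^t$ and $v_2\in W_j^t$; (J2) there is a vertex $v_1\in W_i^t$ with $\mathrm{link}(v_1,W_j^t)\ge\theta$; (J3) there is a vertex $v_1\in W_i^t$ with $\mathrm{coll}(v_1,W_j^t)\ge\sigma$ and $\mathrm{link}(v_1,W_j^t)\ge\tau$. Then $\mathcal{P}^{t+1}$ is obtained by merging all sets of $\mathcal{P}^t$ that belong to the same connected component of $\mathcal{G}_t$. $\mathrm{Solve}$ is the event that, starting from $\mathcal{P}^0$ consisting of all singletons, $\mathcal{P}^t=\{V\}$ for some $t$. AE (adjacent-edge) dynamics is the case $\sigma=\tau=1$, $\theta=\infty$. Graphs. $\mathbb{Z}_n=\{0,1,\dots,n-1\}$ with periodic boundary conditions. Lattice edges connect nearest neighbors. In the hypercube and in the Hamming graph, two vertices are connected by an edge when they differ in exactly one coordinate. All graphs are without loops.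
   Formalization: The Hamming graph is taken with d ≥ 2: for d = 1 it is the complete graph, p = μ/((N−1) log N), the people graph is disconnected with high probability and P(Solve) → 0 for every μ. *)

(* Defs.v *)
From mathcomp Require Import all_boot all_order all_algebra.
From mathcomp Require Import all_classical all_reals all_analysis.
Import Order.TTheory GRing.Theory Num.Theory.
Import numFieldNormedType.Exports.
Set Implicit Arguments.
Unset Strict Implicit.
Unset Printing Implicit Defensive.

Local Open Scope ring_scope.

(* A simple graph on a finite type T is given by its adjacency relation, a
   symmetric and irreflexive e : rel T. *)

Definition nb_neighbors (T : finType) (e : rel T) (v : T) (S : {set T}) : nat :=
  #|[set w in S :\ v | e v w]|.

Definition max_degree (T : finType) (e : rel T) : nat :=
  \max_(v : T) #|[set w | e v w]|.

Section Jigsaw.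
Variables (T : finType) (puz ppl : rel T).
Variables (sigma tau : nat) (theta : option nat).  (* None is theta = oo *)

Definition link (v : T) (S : {set T}) : nat := nb_neighbors puz v S.
Definition coll (v : T) (S : {set T}) : nat := nb_neighbors ppl v S.

Definition doubly_connected (v1 v2 : T) : bool := puz v1 v2 && ppl v1 v2.

Definition J1 (W1 W2 : {set T}) : bool :=
  [exists v1 in W1, exists v2 in W2, doubly_connected v1 v2].

Definition J2 (W1 W2 : {set T}) : bool :=
  if theta is Some th then [exists v1 in W1, (th <= link v1 W2)%N] else false.

Definition J3 (W1 W2 : {set T}) : bool :=
  [exists v1 in W1, (sigma <= coll v1 W2)%N && (tau <= link v1 W2)%N].

Definition mergeable (W1 W2 : {set T}) : bool :=
  [|| J1 W1 W2, J2 W1 W2 | J3 W1 W2].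

Definition cluster_graph (P : {set {set T}}) : rel {set T} :=
  fun W1 W2 => [&& W1 \in P, W2 \in P, W1 != W2 &
                   mergeable W1 W2 || mergeable W2 W1].

Definition jigsaw_step (P : {set {set T}}) : {set {set T}} :=
  [set finset.cover [set W' in P | connect (cluster_graph P) W W'] | W in P].

Definition singletons : {set {set T}} := [set [set v] | v : T].

Definition jigsaw_partition (t : nat) : {set {set T}} :=
  iter t jigsaw_step singletons.

Definition jigsaw_solve : Prop :=
  exists t : nat, jigsaw_partition t = [set [set: T]].

End Jigsaw.

Definition AE_solve (T : finType) (puz ppl : rel T) : Prop :=
  jigsaw_solve puz ppl 1 1 None.

(* The Erdos-Renyi graph: an outcome is the set E of the unordered pairs of
   distinct vertices that are edges. *)

Definition vertex_pairs (T : finType) : {set {set T}} :=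
  [set e : {set T} | #|e| == 2%N].

Definition edge_rel (T : finType) (E : {set {set T}}) : rel T :=
  fun u v => [set u; v] \in E.

Definition ER_weight (R : realType) (T : finType) (p : R)
    (E : {set {set T}}) : R :=
  \prod_(e in vertex_pairs T) (if e \in E then p else 1 - p).

(* This is a probability only if 0 <= p <= 1; it is the plain polynomial
   expression in p otherwise. *)
Definition ER_prob (R : realType) (T : finType) (p : R)
    (A : rel T -> Prop) : R :=
  \sum_(E in powerset (vertex_pairs T) | `[< A (edge_rel E) >]) ER_weight p E.

(* mu / (D log N).  For fixed mu >= 0 and graphs without isolated vertices it
   is at most 1 as soon as N is large, so that out-of-range values do not
   affect limits as N tends to infinity. *)
Definition scaled_p (R : realType) (T : finType) (puz : rel T) (mu : R) : R :=
  mu / ((max_degree puz)%:R * ln (#|T|%:R : R)).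

Definition AE_solve_prob (R : realType) (T : finType) (puz : rel T)
    (mu : R) : R :=
  ER_prob (scaled_p puz mu) (AE_solve puz).

(* Distance in the cyclic group of integers mod n, on representatives in
   {0, ..., n-1}. *)
Definition cyc_dist (n : nat) (a b : 'I_n) : nat :=
  minn ((a + (n - b)) %% n) ((b + (n - a)) %% n).

Definition torus_adj (d n : nat) : rel {ffun 'I_d -> 'I_n} :=
  fun x y => (\sum_(i < d) cyc_dist (x i) (y i))%N == 1%N.

Definition range_adj (r n : nat) : rel {ffun 'I_2 -> 'I_n} :=
  fun x y => (x != y) && (\max_(i < 2) cyc_dist (x i) (y i) <= r)%N.

Definition differ_in_one (d : nat) (A : eqType) : rel {ffun 'I_d -> A} :=
  fun x y => #|[set i | x i != y i]| == 1%N.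

Definition hypercube_adj (n : nat) : rel {ffun 'I_n -> bool} :=
  @differ_in_one n bool.

Definition hamming_adj (d n : nat) : rel {ffun 'I_d -> 'I_n} :=
  @differ_in_one d 'I_n.

(* Main.v *)
Require Import Defs.
From mathcomp Require Import all_boot all_order all_algebra.
From mathcomp Require Import all_classical all_reals all_analysis.
From mathcomp Require Import ring lra zify.
(* Imported again so that finite sets shadow the classical sets. *)
From mathcomp Require Import fintype finset.
Import Order.TTheory GRing.Theory Num.Theory.
Import numFieldNormedType.Exports.

(* A cluster W of k vertices with at least c D untested puzzle neighbors grows
   with probability at least 1 - (1 - p)^(c D k), about 1 - exp(-c mu k / log N).
   The product of these factors over all k is at least N^(-C/(c mu)), because
   the integral of -log(1 - exp(-x)) over x > 0 is finite. If a batch of c D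
   neighbors can always be chosen among vertices that have not been tested yet,
   the steps are independent; for large mu, a small power of N of attempts then
   succeeds with high probability in making a cluster of K >= 4 D (log N)^2
   vertices. An independent sprinkling of people edges connects every other
   vertex to this cluster, and since the puzzle graph is connected, everything
   merges.

   Untested neighbors are found as follows. In the torus and in the range-r
   graph, one follows a path that is increasing in one or all coordinates, in
   disjoint boxes or strips. In the hypercube, one follows increasing paths in
   four blocks of coordinates, nested as a comb, in disjoint subcubes. In the
   Hamming graph, every step uses a coordinate value that was never used. *)

Set Implicit Arguments.
Unset Strict Implicit.
Unset Printing Implicit Defensive.
Local Open Scope ring_scope.

(** * Random subsets *)

(** The probability of growth is estimated only once, for the game [grow], in which an adversary
    picks among the successful candidates. A strategy for a particular graph is then a purely
    combinatorial object, which has to supply fresh batches after every possible history. Since only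
    pairs that meet fresh vertices must still be unrevealed, a failed run costs nothing but the
    vertices that it tested. The obstacle is the supply of fresh neighbors: batches of order D must
    last for a whole run and for about N^(1/64) runs. In the Hamming graph every step consumes one
    of only n coordinate values, fewer than the D (log N)^2 vertices required, so a run stops at
    [K1] vertices and a second stage takes over. The cluster is then so large that batches much
    smaller than D succeed with high probability; that stage needs no restart and can live on
    coordinate values reserved for it. *)

Section RandomSubset.
Variables (R : realType) (I : finType).
Implicit Types (p : R) (S F E : {set I}) (f g : {set I} -> R).

(** The expectation of [f] at a random subset of [S] that keeps each element independently with
    probability [p]. Being polynomial in [p], it satisfies the algebraic identities for every [p];
    only comparisons need 0 <= p <= 1. *)
Definition Esubset p S f : R :=
  \sum_(E in powerset S) (\prod_(e in S) (if e \in E then p else 1 - p)) * f E.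

Lemma eq_Esubset p S f g :
  (forall E, E \subset S -> f E = g E) -> Esubset p S f = Esubset p S g.
Proof.
by move=> fg; apply: eq_bigr => E; rewrite powersetE => /fg ->.
Qed.

Lemma Esubset_set0 p f : Esubset p set0 f = f set0.
Proof.
by rewrite /Esubset powerset0 big_set1 big_set0 mul1r.
Qed.

(** Independence over disjoint index sets, a finite Fubini theorem: [E] corresponds to the pair of
    its traces on [S1] and [S2]. *)
Lemma Esubset_setU p S1 S2 f : [disjoint S1 & S2] ->
  Esubset p (S1 :|: S2) f = Esubset p S1 (fun E1 => Esubset p S2 (fun E2 => f (E1 :|: E2))).
Proof.
move=> dis.
have dI : S1 :&: S2 = set0 by apply/eqP; rewrite setI_eq0.
rewrite /Esubset.
under [RHS]eq_bigr => E1 _ do rewrite big_distrr.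
rewrite pair_big_dep /=.
rewrite (reindex_onto (fun P : {set I} * {set I} => P.1 :|: P.2)
  (fun E => (E :&: S1, E :&: S2))) /=; last first.
  by move=> E; rewrite powersetE -setIUr => /setIidPl.
apply: eq_big => [[E1 E2]|[E1 E2]] /=.
  rewrite !powersetE; apply/andP/andP => [[sE /eqP[<- <-]]|[s1 s2]].
    by rewrite !subsetIr.
  split; first exact: setUSS.
  have d12 : E2 :&: S1 = set0.
    by apply/eqP; rewrite -subset0 -dI setIC setIS.
  have d21 : E1 :&: S2 = set0 by apply/eqP; rewrite -subset0 -dI setSI.
  rewrite !setIUl d12 d21 setU0 set0U.
  by move/setIidPl: s1 => ->; move/setIidPl: s2 => ->.
rewrite !powersetE => /andP[sE /eqP[e1 e2]].
have s1 : E1 \subset S1 by rewrite -e1 subsetIr.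
have s2 : E2 \subset S2 by rewrite -e2 subsetIr.
rewrite mulrA; congr (_ * _).
rewrite (eq_bigl [predU S1 & S2]) /=; last by move=> e; rewrite !inE.
rewrite bigU //=; congr (_ * _); apply: eq_bigr => e eS.
  rewrite inE; case: (boolP (e \in E2)) => [eE|]; last by rewrite orbF.
  by have := subsetP s2 _ eE; rewrite (disjointFr dis eS).
rewrite inE; case: (boolP (e \in E1)) => [eE|] //.
by have := subsetP s1 _ eE; rewrite (disjointFl dis eS).
Qed.

Lemma Esubset_set1 p e f : Esubset p [set e] f = p * f [set e] + (1 - p) * f set0.
Proof.
rewrite /Esubset (bigD1 set0) ?powersetE ?sub0set //= addrC; congr (_ + _).
  rewrite (big_pred1 [set e]) => [|E]; first by rewrite big_set1 inE eqxx.
  rewrite powersetE subset1; case: (E =P [set e]) => [->|/eqP/negPf ne].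
    by rewrite -cards_eq0 cards1 [RHS]eqxx.
  by rewrite orFb andbN [RHS]ne.
by rewrite big_set1 inE.
Qed.

Lemma EsubsetD p S f g : Esubset p S (fun E => f E + g E) = Esubset p S f + Esubset p S g.
Proof. by rewrite /Esubset -big_split; apply: eq_bigr => E _; rewrite mulrDr. Qed.

Lemma EsubsetZ p S c f : Esubset p S (fun E => c * f E) = c * Esubset p S f.
Proof. by rewrite /Esubset big_distrr; apply: eq_bigr => E _ /=; rewrite mulrCA. Qed.

Lemma Esubset_sum p S (J : finType) (P : pred J) (f : J -> {set I} -> R) :
  Esubset p S (fun E => \sum_(j | P j) f j E) = \sum_(j | P j) Esubset p S (f j).
Proof. by rewrite /Esubset exchange_big; apply: eq_bigr => E _; rewrite big_distrr. Qed.

Lemma Esubset_setU1 p e S f : e \notin S ->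
  Esubset p (e |: S) f =
  p * Esubset p S (fun E => f (e |: E)) + (1 - p) * Esubset p S f.
Proof.
move=> eS; rewrite Esubset_setU ?disjoints1 // Esubset_set1; congr (_ * _ + _ * _).
by apply: eq_Esubset => E _; rewrite set0U.
Qed.

Lemma set_ind (P : {set I} -> Prop) :
  P set0 -> (forall e S, e \notin S -> P S -> P (e |: S)) -> forall S, P S.
Proof.
move=> P0 PU S; have [k] := ubnP #|S|; elim: k S => // k IH S.
case: (set_0Vmem S) => [->//|[e eS]] cS.
rewrite -(setD1K eS); apply: PU; first by rewrite !inE eqxx.
by apply: IH; move: cS; rewrite (cardsD1 e) eS.
Qed.

Lemma Esubset_cst p S c : Esubset p S (fun=> c) = c.
Proof.
elim/set_ind: S => [|e S eS IH]; first by rewrite Esubset_set0.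
by rewrite Esubset_setU1 // IH; ring.
Qed.

(** An element lies in the union of two independent random sets with probability 1 - (1 - p1)(1 -
    p2). In the induction, the three cases in which the new element is present collapse to one. *)
Lemma Esubset_sprinkle p1 p2 S f :
  Esubset (p1 + p2 - p1 * p2) S f =
  Esubset p1 S (fun E1 => Esubset p2 S (fun E2 => f (E1 :|: E2))).
Proof.
elim/set_ind: S f => [|e S eS IH] f; first by rewrite !Esubset_set0 setU0.
rewrite !Esubset_setU1 // !IH.
under [X in _ = _ * X + _]eq_Esubset => E1 _ do rewrite Esubset_setU1 //.
under [X in _ = _ + _ * X]eq_Esubset => E1 _ do rewrite Esubset_setU1 //.
rewrite !EsubsetD !EsubsetZ.
have -> : Esubset p1 S (fun E1 => Esubset p2 S (fun E => f ((e |: E1) :|: (e |: E)))) =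
  Esubset p1 S (fun E1 => Esubset p2 S (fun E2 => f (e |: (E1 :|: E2)))).
  apply: eq_Esubset => E1 _; apply: eq_Esubset => E2 _.
  by rewrite setUACA setUid.
have -> : Esubset p1 S (fun E1 => Esubset p2 S (fun E => f ((e |: E1) :|: E))) =
  Esubset p1 S (fun E1 => Esubset p2 S (fun E2 => f (e |: (E1 :|: E2)))).
  by apply: eq_Esubset => E1 _; apply: eq_Esubset => E2 _; rewrite setUA.
have -> : Esubset p1 S (fun E1 => Esubset p2 S (fun E => f (E1 :|: (e |: E)))) =
  Esubset p1 S (fun E1 => Esubset p2 S (fun E2 => f (e |: (E1 :|: E2)))).
  by apply: eq_Esubset => E1 _; apply: eq_Esubset => E2 _; rewrite setUCA.
ring.
Qed.

Section Proba.
Variable p : R.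
Hypothesis p01 : 0 <= p <= 1.

Lemma le_Esubset S f g :
  (forall E, E \subset S -> f E <= g E) -> Esubset p S f <= Esubset p S g.
Proof.
move=> fg; apply: ler_sum => E; rewrite powersetE => /fg fgE.
apply: ler_wpM2l => //; apply: prodr_ge0 => e _.
by case/andP: p01 => p0 p1; case: ifP; rewrite ?subr_ge0.
Qed.

Lemma Esubset_subset S' S f : S' \subset S ->
  (forall E E' : {set I}, E \subset E' -> f E <= f E') ->
  Esubset p S' f <= Esubset p S f.
Proof.
move=> sS fm; rewrite -(setID S S') (setIidPr sS) setUC.
rewrite Esubset_setU; last by rewrite disjoints_subset setDE subsetIr.
rewrite -[leLHS](Esubset_cst p (S :\: S')); apply: le_Esubset => E1 _.
by apply: le_Esubset => E2 _; apply: fm; rewrite subsetUr.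
Qed.

Lemma Esubset_disjoint F S : F \subset S ->
  Esubset p S (fun E => [disjoint E & F]%:R) = (1 - p) ^+ #|F|.
Proof.
move=> sF; rewrite -(setID S F) (setIidPr sF).
rewrite Esubset_setU; last by rewrite disjoint_sym disjoints_subset setDE subsetIr.
transitivity (Esubset p F (fun E => (E == set0)%:R)).
  apply: eq_Esubset => E1 s1; rewrite -[RHS](Esubset_cst p (S :\: F)).
  apply: eq_Esubset => E2 s2; congr (_ %:R); congr nat_of_bool.
  rewrite -setI_eq0 setIUl (setIidPl s1).
  suff -> : E2 :&: F = set0 by rewrite setU0.
  apply/eqP; rewrite setI_eq0 disjoints_subset (subset_trans s2) //.
  by rewrite setDE subsetIr.
rewrite /Esubset (bigD1 set0) ?powersetE ?sub0set //= eqxx mulr1.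
rewrite [X in _ + X]big1 => [|E /andP[_ /negPf ->]]; last by rewrite mulr0.
by rewrite addr0 -prodr_const; apply: eq_bigr => e _; rewrite inE.
Qed.

End Proba.
End RandomSubset.

Lemma ER_probE (R : realType) (T : finType) (p : R) (A : rel T -> Prop) :
  ER_prob p A = Esubset p (vertex_pairs T) (fun E => `[< A (edge_rel E) >]%:R).
Proof.
rewrite /ER_prob /Esubset big_mkcondr; apply: eq_bigr => E _.
by case: asbool; rewrite ?mulr1 ?mulr0.
Qed.

(** * Jigsaw percolation and growing clusters *)

Section JigsawPartitions.
Variables (T : finType) (puz ppl : rel T) (sigma tau : nat) (theta : option nat).
Local Notation cg := (cluster_graph puz ppl sigma tau theta).
Local Notation step := (jigsaw_step puz ppl sigma tau theta).
Local Notation part := (jigsaw_partition puz ppl sigma tau theta).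

Lemma cluster_graph_sym P : connect_sym (cg P).
Proof.
apply: sym_connect_sym => W1 W2.
by rewrite /cluster_graph andbCA eq_sym [X in [&& _, _, _ & X]]orbC.
Qed.

Definition jigsaw_block (P : {set {set T}}) (W : {set T}) :=
  finset.cover [set W' in P | connect (cg P) W W'].

Lemma mem_jigsaw_step (P : {set {set T}}) W : W \in P -> jigsaw_block P W \in step P.
Proof. by move=> WP; apply: (imset_f (jigsaw_block P)). Qed.

Lemma mem_jigsaw_block (P : {set {set T}}) W v :
  reflect (exists W', [/\ W' \in P, connect (cg P) W W' & v \in W'])
          (v \in jigsaw_block P W).
Proof.
apply: (iffP bigcupP) => [[W']|[W' [W'P c vW']]].
  by rewrite inE => /andP[W'P c] vW'; exists W'.
by exists W'; rewrite ?inE ?W'P.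
Qed.

Lemma jigsaw_partitionP t : finset.partition (part t) [set: T].
Proof.
elim: t => [|t].
  apply/and3P; split; first apply/eqP/setP => v.
  - rewrite [RHS]inE; apply/bigcupP; exists [set v]; last by rewrite inE.
    by apply: imset_f.
  - apply/trivIsetP => _ _ /imsetP[u _ ->] /imsetP[v _ ->] uv.
    by rewrite disjoints1 inE; apply: contraNneq uv => ->.
  - by apply/imsetP => -[v _] /setP/(_ v); rewrite !inE eqxx.
rewrite -[part t.+1]/(step (part t)); move: (part t) => P /and3P[/eqP cP tP nP].
apply/and3P; split.
- apply/eqP/setP => v; rewrite [RHS]inE; apply/bigcupP.
  have : v \in finset.cover P by rewrite cP inE.
  case/bigcupP => W WP vW; exists (jigsaw_block P W); first exact: mem_jigsaw_step.
  by apply/mem_jigsaw_block; exists W.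
- apply/trivIsetP => _ _ /imsetP[W1 W1P ->] /imsetP[W2 W2P ->].
  apply: contraR => /pred0Pn[v /andP[/= /mem_jigsaw_block[W1' [W1'P c1 v1]]]].
  case/mem_jigsaw_block => W2' [W2'P c2 v2].
  have e : W1' = W2'.
    apply/eqP; apply: contraTT v1 => /(trivIsetP tP _ _ W1'P W2'P).
    by move/disjointFl => /(_ v v2) ->.
  apply/eqP; congr finset.cover; apply/setP => W; rewrite !inE.
  congr (_ && _); apply: same_connect; first exact: cluster_graph_sym.
  by apply: (connect_trans c1); rewrite e cluster_graph_sym.
- apply/imsetP => -[W WP /esym/eqP].
  have /set0Pn[v vW] : W != set0 by apply: contraNneq nP => <-.
  rewrite -subset0 => /subsetP/(_ v); rewrite inE => h.
  by apply/notF/h/mem_jigsaw_block; exists W.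
Qed.

Lemma jigsaw_step_merge (P : {set {set T}}) W1 W2 : W1 \in P -> W2 \in P ->
  W1 = W2 \/ mergeable puz ppl sigma tau theta W1 W2 ->
  exists2 W, W \in step P & W1 :|: W2 \subset W.
Proof.
move=> W1P W2P m; exists (jigsaw_block P W1); first exact: mem_jigsaw_step.
have c : connect (cg P) W1 W2.
  have [->//|ne] := eqVneq W1 W2.
  case: m => [e|m]; first by rewrite e eqxx in ne.
  by apply: connect1; rewrite /cluster_graph W1P W2P ne m.
by apply/subsetP => v; rewrite inE => /orP[] h; apply/mem_jigsaw_block;
  [exists W1 | exists W2].
Qed.

Lemma jigsaw_solveP t : [set: T] \in part t -> jigsaw_solve puz ppl sigma tau theta.
Proof.
move=> h; exists t; apply/setP => W; rewrite inE.
have /and3P[_ tP nP] := jigsaw_partitionP t.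
apply/idP/eqP => [WP|->//].
apply/eqP; apply: contraNT nP => /(trivIsetP tP _ _ WP h).
by rewrite disjoints_subset setCT subset0 => /eqP <-.
Qed.

End JigsawPartitions.

(** * Clusters assembled one vertex at a time *)

Section Assembly.
Variables (T : finType) (puz : rel T).
Implicit Types (W : {set T}) (E : {set {set T}}).

(** Single vertices suffice, because J3 with sigma = tau = 1 asks one vertex [b] for a puzzle
    neighbor and a people neighbor, possibly different, in the cluster. *)
Inductive assembled E : {set T} -> Prop :=
| assembled1 v : assembled E [set v]
| assembledU W b :
    assembled E W ->
    (exists2 w, w \in W & puz b w) ->
    (exists2 w, w \in W & [set b; w] \in E) -> assembled E (b |: W).

Lemma assembledS E E' W : E \subset E' -> assembled E W -> assembled E' W.
Proof.
move=> sE; elim => [v|{}W b _ IH pb [w wW bw]]; first exact: assembled1.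
by apply: assembledU => //; exists w => //; apply: (subsetP sE).
Qed.

(** The blocks of [W] and of [b] may be larger than [W] and [{b}], but J3 looks only at the vertex
    [b], so they merge at the next step unless they coincide. If they differ, [b] is outside the
    block of [W], and excluding [b] from the neighbor counts loses nothing. *)
Lemma assembled_block E W : assembled E W ->
  exists t, exists2 B, B \in jigsaw_partition puz (edge_rel E) 1 1 None t & W \subset B.
Proof.
elim => [v|{}W b _ [t [B BP sB]] [w wW pw] [w' w'W ew']].
  by exists 0%N, [set v] => //; apply: imset_f.
have /and3P[/eqP cP _ _] := jigsaw_partitionP puz (edge_rel E) 1 1 None t.
have : b \in [set: T] by rewrite inE.
rewrite -{1}cP => /bigcupP[B' B'P bB'].
have [W' W'P sW'] : exists2 W', W' \in jigsaw_partition puz (edge_rel E) 1 1 None t.+1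
    & B' :|: B \subset W'.
  rewrite -[jigsaw_partition _ _ _ _ _ _]/(jigsaw_step _ _ _ _ _ (jigsaw_partition _ _ _ _ _ t)).
  apply: jigsaw_step_merge => //.
  have [bB|bB] := boolP (b \in B); [left|right].
    have /and3P[_ tP _] := jigsaw_partitionP puz (edge_rel E) 1 1 None t.
    apply/eqP; apply: contraTT bB => /(trivIsetP tP _ _ B'P BP).
    by move/disjointFr => /(_ b bB') ->.
  apply/or3P; apply: Or33; apply/exists_inP; exists b => //.
  have nb w0 : w0 \in W -> w0 \in B :\ b.
    move=> /(subsetP sB) w0B; rewrite !inE w0B andbT.
    by apply: contraNneq bB => <-.
  apply/andP; split; apply/card_gt0P.
    by exists w'; rewrite inE nb.
  by exists w; rewrite inE nb.
exists t.+1, W' => //; apply: subset_trans sW'.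
by rewrite setUSS // sub1set.
Qed.

Lemma assembled_solve E : assembled E [set: T] -> AE_solve puz (edge_rel E).
Proof.
case/assembled_block => t [B BP sB]; apply: (@jigsaw_solveP _ _ _ _ _ _ t).
by move: sB; rewrite subTset => /eqP <-.
Qed.

Lemma assembled_neq0 E W : assembled E W -> W != set0.
Proof. by case=> [v|W' b _ _ _]; apply/set0Pn; [exists v|exists b]; rewrite !inE eqxx. Qed.

(** On a puzzle path from an outside vertex into [W], the last vertex before entering has a puzzle
    neighbor in [W], and its people edge is given. The hypothesis on outside vertices survives as
    [W] grows. *)
Lemma assembled_spread E W : (forall u v, connect puz u v) ->
  assembled E W ->
  (forall v, v \notin W -> exists2 w, w \in W & [set v; w] \in E) ->
  assembled E [set: T].
Proof.
move=> conn; have [k] := ubnP #|~: W|; elim: k W => // k IH W kW aW far.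
have [WT|nWT] := eqVneq (~: W) set0.
  by rewrite -(setCK W) WT setC0 in aW.
have [v vW] := set0Pn _ nWT; rewrite inE in vW.
have [w wW] := set0Pn _ (assembled_neq0 aW).
have [b bW [u uW pu]] : exists2 b, b \notin W & exists2 u, u \in W & puz b u.
  have /connectP[s] := conn v w; elim: s v vW => [|x s IHs] v vW /=.
    by move=> _ e; rewrite -e wW in vW.
  case/andP => vx px lx; have [xW|xW] := boolP (x \in W); last exact: IHs px lx.
  by exists v => //; exists x.
apply: (IH (b |: W)).
- rewrite -ltnS (leq_trans _ kW) // ltnS (cardsD1 b (~: W)) inE bW add1n ltnS.
  by rewrite subset_leq_card //; apply/subsetP => x; rewrite !inE negb_or.
- by apply: assembledU => //; [exists u|apply: far].
- move=> x; rewrite inE negb_or => /andP[_ /far[y yW xy]].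
  by exists y; rewrite // inE yW orbT.
Qed.

End Assembly.

(** * The exploration game and its success probability *)

Section Growth.
Variables (T : finType) (puz : rel T).
Implicit Types (W X Y Z B : {set T}) (E H : {set {set T}}).

(* X is the set of fresh vertices: every pair that meets X is still unrevealed.
   A step tests a batch B of at least m fresh puzzle neighbors of the cluster W
   against W. If some pair of B x W is a people edge, an adversary picks which
   of the successful b joins W; if there is none, Q has to hold of the vertices
   that remain fresh. Post is the goal after j successful steps. *)
Fixpoint grow (m : nat) (Q : {set T} -> Prop) (Post : {set T} -> {set T} -> Prop)
    (j : nat) X W : Prop :=
  if j is j'.+1 then
    exists B, [/\ B \subset X, (m <= #|B|)%N, Q (X :\: B) &
      forall b, b \in B -> (exists2 w, w \in W & puz b w) /\
        grow m Q Post j' (X :\: B) (b |: W)]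
  else Post X W.

(** The strategy never touches the extra vertices [Z], so they are still fresh when control passes
    to [Q'] or [Post']. This allows strategies in disjoint regions to be concatenated. *)
Lemma grow_frame m (Q Q' : {set T} -> Prop) (Post Post' : {set T} -> {set T} -> Prop)
    Z j X W :
  [disjoint X & Z] ->
  (forall X, [disjoint X & Z] -> Q X -> Q' (X :|: Z)) ->
  (forall X W, [disjoint X & Z] -> Post X W -> Post' (X :|: Z) W) ->
  grow m Q Post j X W -> grow m Q' Post' j (X :|: Z) W.
Proof.
move=> dXZ QQ PP; elim: j X W dXZ => [|j IH] X W dXZ /=; first exact: PP.
move=> [B [sB mB QB gB]]; exists B.
have -> : (X :|: Z) :\: B = (X :\: B) :|: Z.
  rewrite setDUl; congr (_ :|: _); apply/setDidPl.
  by rewrite disjoint_sym (disjointWl sB).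
have dBZ : [disjoint X :\: B & Z] by rewrite (disjointWl _ dXZ) // subsetDl.
split; rewrite ?(subset_trans sB (subsetUl _ _)) //; first exact: QQ.
by move=> b /gB[pb gb]; split=> //; apply: IH.
Qed.

Lemma grow_trans m Q Post i j X W :
  grow m Q (grow m Q Post j) i X W -> grow m Q Post (i + j) X W.
Proof.
elim: i X W => [|i IH] X W //= [B [sB mB QB gB]]; exists B; split=> //.
by move=> b /gB[pb gb]; split => //; apply: IH.
Qed.

Section Bound.
Variables (R : realType) (p : R).
Hypothesis p01 : 0 <= p <= 1.

Definition big_assembled K E := exists2 W : {set T}, (K <= #|W|)%N & assembled puz E W.

Lemma big_assembledS K E E' : E \subset E' -> big_assembled K E -> big_assembled K E'.
Proof. by move=> sE [W KW /(assembledS sE) aW]; exists W. Qed.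

Definition pairs_meeting X : {set {set T}} :=
  [set e in vertex_pairs T | ~~ [disjoint e & X]].

(* The probability of a large assembled set when the pairs meeting X are random
   and, among the others, exactly those of H are known to be edges. *)
Definition pr_big K X H : R :=
  Esubset p (pairs_meeting X) (fun E => `[< big_assembled K (E :|: H) >]%:R).

Definition cross_pairs B W : {set {set T}} := [set [set u.1; u.2] | u in setX B W].

Lemma pair_eqP (a b c d : T) : [set a; b] = [set c; d] ->
  a = c /\ b = d \/ a = d /\ b = c.
Proof.
move=> /setP e; have := e a; have := e b; have := e c; have := e d.
rewrite !inE !eqxx !orbT /= => /orP hd /orP hc /esym/orP hb /esym/orP ha.
case: ha => /eqP ha; case: hb => /eqP hb; subst; auto.
- by case: hd => /eqP ->; left.
- by case: hc => /eqP ->; left.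
Qed.

Lemma card_cross_pairs B W : [disjoint B & W] -> #|cross_pairs B W| = (#|B| * #|W|)%N.
Proof.
move=> dBW; rewrite -cardsX; apply: card_in_imset => -[a b] [c d].
rewrite !inE /= => /andP[aB bW] /andP[cB dW] /pair_eqP[[-> ->]//|[ad _]].
by move: dW; rewrite -ad (disjointFr dBW aB).
Qed.

Lemma cross_pairs_sub B W X : [disjoint B & W] -> B \subset X ->
  cross_pairs B W \subset pairs_meeting X.
Proof.
move=> dBW sB; apply/subsetP => e /imsetP[[b w]]; rewrite inE /= => /andP[bB wW] ->.
rewrite !inE cards2; have [bw|_] := eqVneq b w.
  by move: wW; rewrite -bw (disjointFr dBW bB).
rewrite eqxx /=; apply/pred0Pn; exists b; rewrite /= !inE eqxx /=; exact: (subsetP sB).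
Qed.

(* The pairs between B and W are disjoint from those meeting X :\: B, so the
   outcome of the test is independent of the continuation. *)
Lemma prob_cross_pairs B W X (x y : R) (f : {set {set T}} -> R) :
  [disjoint X & W] -> B \subset X ->
  (forall E E', E \subset E' -> f E <= f E') ->
  (forall E b w, b \in B -> w \in W -> [set b; w] \in E ->
     x <= Esubset p (pairs_meeting (X :\: B)) (fun E' => f (E :|: E'))) ->
  y <= Esubset p (pairs_meeting (X :\: B)) f ->
  (1 - (1 - p) ^+ (#|B| * #|W|)) * x + (1 - p) ^+ (#|B| * #|W|) * y
    <= Esubset p (pairs_meeting X) f.
Proof.
move=> dXW sB fm hx hy.
have dBW : [disjoint B & W] by apply: disjointWl dXW.
pose F := cross_pairs B W.
have dF : [disjoint F & pairs_meeting (X :\: B)].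
  rewrite disjoint_sym disjoints_subset; apply/subsetP => e; rewrite !inE.
  move=> /andP[_]; apply: contraNN => /imsetP[[b w]]; rewrite inE /= => /andP[bB wW] ->.
  rewrite disjoints_subset; apply/subsetP => u; rewrite !inE negb_and negbK.
  by case/orP => /eqP ->; rewrite ?bB // (disjointFl dXW wW) orbT.
have sFX : F :|: pairs_meeting (X :\: B) \subset pairs_meeting X.
  rewrite subUset cross_pairs_sub //=; apply/subsetP => e; rewrite !inE.
  move=> /andP[-> /=]; apply: contraNN => /disjointWr; apply.
  exact: subsetDl.
apply: le_trans (Esubset_subset p01 sFX fm); rewrite Esubset_setU // -card_cross_pairs // -/F.
have -> : (1 - (1 - p) ^+ #|F|) * x + (1 - p) ^+ #|F| * y =
  Esubset p F (fun E => x + (y - x) * [disjoint E & F]%:R).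
  by rewrite EsubsetD EsubsetZ Esubset_cst Esubset_disjoint //; move: (_ ^+ _) => z; ring.
apply: le_Esubset => // E sE; have [dE|] := boolP [disjoint E & F].
  rewrite mulr1 addrC subrK; apply: le_trans hy _; apply: le_Esubset => // E' _.
  by apply: fm; apply: subsetUr.
rewrite mulr0 addr0 => /pred0Pn[e /andP[/= eE /imsetP[[b w]]]].
by rewrite inE /= => /andP[bB wW] ee; apply: (hx E b w) => //; rewrite -ee.
Qed.

(** The factor at [k] is the probability that [m] fresh vertices have some edge to a cluster of [k]
    vertices. *)
Definition run_prob (m a b : nat) : R := \prod_(a <= k < b) (1 - (1 - p) ^+ (m * k)).

Let p1p : 0 <= 1 - p <= 1.
Proof. by case/andP: p01 => p0 p1; rewrite subr_ge0 p1 lerBlDr lerDl. Qed.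

Let expp_ge0 k : 0 <= (1 - p) ^+ k.
Proof. by case/andP: p1p => h _; exact: exprn_ge0. Qed.

Let expp_le1 k : (1 - p) ^+ k <= 1.
Proof. by case/andP: p1p => h h'; exact: exprn_ile1. Qed.

Lemma run_prob_ge0 m a b : 0 <= run_prob m a b.
Proof. by apply: prodr_ge0 => k _; rewrite subr_ge0. Qed.

Lemma run_prob_le1 m a b : run_prob m a b <= 1.
Proof.
rewrite /run_prob; apply: prodr_ile1 => k _.
by rewrite subr_ge0 expp_le1 lerBlDr lerDl expp_ge0.
Qed.

(** Success in all steps is worth [t], a failure at any step is worth [s], and [run_prob] is the
    weight of success. At a failure the cluster and the known edges [H] are given up, since
    forgetting edges can only lower the probability of a large assembled set. *)
Lemma grow_bound m (Q : {set T} -> Prop) Post K n s t j X W H :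
  s <= t ->
  (forall X, Q X -> s <= pr_big K X finset.set0) ->
  (forall X W H, [disjoint X & W] -> #|W| = n -> assembled puz H W ->
     Post X W -> t <= pr_big K X H) ->
  [disjoint X & W] -> (#|W| + j)%N = n -> assembled puz H W ->
  grow m Q Post j X W ->
  s + (t - s) * run_prob m #|W| n <= pr_big K X H.
Proof.
move=> st Qs Pt; elim: j X W H => [|j IH] X W H dXW cn aW /=.
  rewrite addn0 in cn; move=> PXW.
  rewrite /run_prob big_geq ?cn // mulr1 addrC subrK.
  exact: Pt PXW.
case=> B [sB mB QB gB].
set r := run_prob m #|W|.+1 n.
have r01 : 0 <= r <= 1 by rewrite run_prob_ge0 run_prob_le1.
have -> : run_prob m #|W| n = (1 - (1 - p) ^+ (m * #|W|)) * r.
  by rewrite /run_prob big_ltn // -cn addnS ltnS leq_addr.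
pose f E : R := `[< big_assembled K (E :|: H) >]%:R.
have fm E E' : E \subset E' -> f E <= f E'.
  move=> sE; rewrite /f; case: asboolP => // h; case: asboolP => // -[].
  by apply: big_assembledS h; rewrite setSU.
have sD : X :\: B \subset X by rewrite subsetDl.
have h := @prob_cross_pairs B W X (s + (t - s) * r) s f dXW sB fm.
have {}h : (1 - (1 - p) ^+ (#|B| * #|W|)) * (s + (t - s) * r) +
   (1 - p) ^+ (#|B| * #|W|) * s <= Esubset p (pairs_meeting X) f.
  apply: h.
  - move=> E b w bB wW bwE; have [pb gb] := gB _ bB.
    have bW : b \notin W by rewrite (disjointFr dXW) // (subsetP sB).
    have cW : #|b |: W| = #|W|.+1 by rewrite cardsU1 bW.
    have := IH (X :\: B) (b |: W) (E :|: H); rewrite cW -/r => IHb.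
    apply: le_trans (IHb _ _ _ gb) _.
    + rewrite disjoint_sym disjoints_subset subUset sub1set !inE bB /=.
      by rewrite -disjoints_subset disjoint_sym (disjointWl sD).
    + by rewrite addSn -addnS.
    + apply: assembledU => //; last by exists w => //; rewrite inE bwE.
      by apply: assembledS aW; apply: subsetUr.
    rewrite /pr_big; apply: le_Esubset => // E' _; rewrite /f.
    by rewrite setUA [E' :|: E]setUC.
  - apply: le_trans (Qs _ QB) _; apply: le_Esubset => // E _.
    rewrite setU0 /f; case: asboolP => // hb; case: asboolP => // -[].
    by apply: big_assembledS hb; apply: subsetUl.
apply: le_trans h.
(* A batch larger than [m] only shifts weight from failure to success, which is worth at least as
   much because s <= t. *)
have q1 : (1 - p) ^+ (#|B| * #|W|) <= (1 - p) ^+ (m * #|W|).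
  by apply: ler_wiXn2l; rewrite ?leq_mul2r ?mB ?orbT //; case/andP: p1p.
have : 0 <= (t - s) * r by rewrite mulr_ge0 ?subr_ge0 //; case/andP: r01.
set z := (1 - p) ^+ (m * _) in q1 *; set z' := (1 - p) ^+ _ in q1 *.
move=> hr; rewrite -subr_ge0.
have -> : (1 - z') * (s + (t - s) * r) + z' * s - (s + (t - s) * ((1 - z) * r)) =
  (z - z') * ((t - s) * r) by ring.
by rewrite mulr_ge0 // subr_ge0.
Qed.

End Bound.
End Growth.

(** * Repeated attempts and sprinkling *)

Section Attempts.
Variables (T : finType) (puz : rel T) (mA K1 mB K : nat).
Implicit Types (X Y Z W : {set T}).

(* K1 vertices are collected with batches of size mA, restarting from a fresh
   vertex upon failure; the last K - K1 ones with batches of size mB, where a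
   failure is so unlikely that there is no restart. *)
Definition extendable X W :=
  grow puz mB (fun=> True) (fun _ _ => True) (K - K1) X W.

Fixpoint attempts (a : nat) X : Prop :=
  if a is a'.+1 then
    exists2 v, v \in X & grow puz mA (attempts a') extendable K1.-1 (X :\ v) [set v]
  else True.

Lemma extendable_frame Z X W :
  [disjoint X & Z] -> extendable X W -> extendable (X :|: Z) W.
Proof. by move=> dXZ; apply: grow_frame. Qed.

Lemma setDU1_disjoint X Z v : [disjoint X & Z] -> v \in X ->
  (X :|: Z) :\ v = (X :\ v) :|: Z.
Proof.
move=> dXZ vX; rewrite setDUl; congr (_ :|: _); apply/setDidPl.
by rewrite disjoint_sym disjoints1 (disjointFr dXZ).
Qed.

Lemma attempts_frame a X Z :
  [disjoint X & Z] -> attempts a X -> attempts a (X :|: Z).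
Proof.
elim: a X => // a IH X dXZ [v vX gX]; exists v; rewrite ?inE ?vX //.
rewrite setDU1_disjoint //; apply: grow_frame gX.
- by rewrite (disjointWl _ dXZ) // subsetDl.
- exact: IH.
- by move=> X' W; apply: extendable_frame.
Qed.

Lemma attemptsS a X X' : X \subset X' -> attempts a X -> attempts a X'.
Proof.
move=> sX aX; rewrite -(setID X' X) (setIidPr sX); apply: attempts_frame => //.
by rewrite disjoint_sym disjoints_subset setDE subsetIr.
Qed.

Lemma attemptsU a b X Y : [disjoint X & Y] ->
  attempts a X -> attempts b Y -> attempts (a + b) (X :|: Y).
Proof.
elim: a X => [|a IH] X dXY aX aY.
  by rewrite add0n setUC; apply: attempts_frame aY; rewrite disjoint_sym.
case: aX => v vX gX; exists v; rewrite ?inE ?vX //.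
rewrite setDU1_disjoint //; apply: grow_frame gX.
- by rewrite (disjointWl _ dXY) // subsetDl.
- by move=> X' dX' aX'; apply: IH.
- by move=> X' W; apply: extendable_frame.
Qed.

(** Attempts inside one region leave all other regions fresh, so their numbers add up. *)
Lemma attempts_family (I : finType) (Y : I -> {set T}) a :
  (forall i j, i != j -> [disjoint Y i & Y j]) ->
  (forall i, attempts a (Y i)) -> attempts (#|I| * a) [set: T].
Proof.
move=> dY aY; rewrite cardE.
have : attempts (size (enum I) * a) (\bigcup_(i <- enum I) Y i).
  elim: (enum I) (enum_uniq I) => [|i s IH] /=; first by [].
  case/andP => iNs us; rewrite big_cons mulSn; apply: attemptsU => //; last exact: IH.
  rewrite disjoint_sym disjoints_subset; apply/subsetP => x.
  rewrite bigcup_seq => /bigcupP[j js xj]; rewrite inE.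
  by rewrite (disjointFr (dY j i _) xj) //; apply: contraNneq iNs => <-.
by apply: attemptsS; apply: subsetT.
Qed.

Section Bound.
Variables (R : realType) (p1 p2 : R).
Hypothesis p1_01 : 0 <= p1 <= 1.
Hypothesis p2_01 : 0 <= p2 <= 1.
Let r := run_prob p1 mA 1 K1.
Let t := run_prob p1 mB K1 K.

(** If [s] is the bound for [M] attempts, one more gives s + (t - s) r, and t (1 - (1 - r)^M) solves
    this recursion starting from 0. *)
Lemma attempts_bound M X : (0 < K1 <= K)%N -> attempts M X ->
  t * (1 - (1 - r) ^+ M) <= pr_big puz p1 K X finset.set0.
Proof.
case/andP => K1_gt0 K1K.
have t0 : 0 <= t by apply: run_prob_ge0.
have r0 : 0 <= r by apply: run_prob_ge0.
have r1 : r <= 1 by apply: run_prob_le1.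
elim: M X => [|M IH] X /=.
  move=> _; rewrite expr0 subrr mulr0.
  rewrite -[leLHS](Esubset_cst p1 (pairs_meeting X)); exact: le_Esubset.
case=> v vX g.
have dXv : [disjoint X :\ v & [set v]].
  by rewrite disjoint_sym disjoints1 !inE eqxx.
set s := t * (1 - (1 - r) ^+ M) in IH.
have st : s <= t.
  by rewrite ler_piMr // lerBlDr lerDl exprn_ge0 // subr_ge0.
have Pt X' W H : [disjoint X' & W] -> #|W| = K1 -> assembled puz H W ->
    extendable X' W -> t <= pr_big puz p1 K X' H.
  move=> dX' cW aW eW.
  have := @grow_bound _ puz _ p1 p1_01 mB (fun=> True) (fun _ _ => True) K K
    0 1 (K - K1) X' W H ler01.
  rewrite add0r subr0 mul1r cW -/t; apply => //; last by rewrite subnKC.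
    move=> X'' _; rewrite -[leLHS](Esubset_cst p1 (pairs_meeting X'')).
    exact: le_Esubset.
  move=> X'' W' H' _ cW' aW' _.
  rewrite -[leLHS](Esubset_cst p1 (pairs_meeting X'')); apply: le_Esubset => // E _.
  case: asboolP => // -[]; exists W'; first by rewrite cW'.
  by apply: assembledS aW'; apply: subsetUr.
have := @grow_bound _ puz _ p1 p1_01 mA (attempts M) extendable K K1 s t K1.-1
  (X :\ v) [set v] finset.set0 st IH Pt dXv.
rewrite cards1 add1n prednK // -/r => /(_ erefl (assembled1 _ _ _) g).
have -> : t * (1 - (1 - r) ^+ M.+1) = s + (t - s) * r by rewrite /s exprS; ring.
move=> /le_trans; apply; rewrite /pr_big; apply: Esubset_subset => //; last first.
  move=> E E' sE; case: asboolP => // hE; case: asboolP => // -[].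
  by apply: big_assembledS hE; rewrite setSU.
apply/subsetP => e; rewrite !inE => /andP[-> /=]; apply: contraNN.
by apply: disjointWr; apply: subsetDl.
Qed.

(** The graph of density [p1] makes a cluster [W] of at least [K] vertices. Given [W], a union bound
    over the vertices outside it bounds the probability that one of them has no edge to [W] in the
    independent graph of density [p2]. *)
Lemma solve_prob_bound M : (0 < K1 <= K)%N -> (forall u v, connect puz u v) ->
  attempts M [set: T] ->
  t * (1 - (1 - r) ^+ M) * (1 - #|T|%:R * (1 - p2) ^+ K) <=
  ER_prob (p1 + p2 - p1 * p2) (AE_solve puz).
Proof.
move=> hK conn aM; rewrite ER_probE Esubset_sprinkle.
set S := vertex_pairs T.
set z := 1 - _ * _ ^+ _.
(* If the last factor is not positive, the claim only says that a probability is nonnegative. *)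
have [z0|z0] := leP z 0.
  apply: le_trans (_ : 0 <= _).
    rewrite mulr_ge0_le0 // mulr_ge0 ?run_prob_ge0 // subr_ge0 exprn_ile1 //.
      by rewrite subr_ge0 run_prob_le1.
    by rewrite lerBlDr lerDl run_prob_ge0.
  rewrite -[leLHS](Esubset_cst p1 S); apply: le_Esubset => // E _.
  by rewrite -[leLHS](Esubset_cst p2 S); exact: le_Esubset.
have -> : S = pairs_meeting [set: T].
  apply/setP => e; rewrite !inE; case: eqVneq => //= ce; apply/esym/pred0Pn.
  have /card_gt0P[x xe] : (0 < #|e|)%N by rewrite ce.
  by exists x; rewrite /= xe inE.
apply: le_trans (_ : Esubset p1 (pairs_meeting [set: T]) (fun E =>
   z * `[< big_assembled puz K (E :|: finset.set0) >]%:R) <= _).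
  rewrite EsubsetZ mulrC; apply: ler_wpM2l; first exact: ltW.
  exact: attempts_bound.
apply: le_Esubset => // E1 _; rewrite setU0; case: asboolP => [[W KW aW]|_]; last first.
  rewrite mulr0 -[leLHS](Esubset_cst p2 (pairs_meeting [set: T])).
  by exact: le_Esubset.
rewrite mulr1.
pose F v := cross_pairs [set v] W.
apply: le_trans (_ : Esubset p2 (pairs_meeting [set: T]) (fun E =>
   1 + (-1) * \sum_(v in ~: W) [disjoint E & F v]%:R) <= _).
  rewrite EsubsetD EsubsetZ Esubset_cst Esubset_sum mulN1r lerD2l lerN2.
  apply: le_trans (_ : \sum_(v in ~: W) (1 - p2) ^+ K <= _).
    apply: ler_sum => v; rewrite inE => vW.
    have dvW : [disjoint [set v] & W] by rewrite disjoints1.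
    rewrite Esubset_disjoint ?cross_pairs_sub ?subsetT // card_cross_pairs // cards1 mul1n.
    case/andP: p2_01 => p20 p21; apply: ler_wiXn2l => //.
      by rewrite subr_ge0.
    by rewrite lerBlDr lerDl.
  rewrite sumr_const mulr_natl ler_wpMn2l //.
    by apply: exprn_ge0; rewrite subr_ge0; case/andP: p2_01.
  exact: max_card.
apply: le_Esubset => // E2 _; case: asboolP => [_|nS].
  by rewrite mulN1r gerDl oppr_le0 sumr_ge0.
suff [v vW dv] : exists2 v, v \in ~: W & [disjoint E2 & F v].
  rewrite (bigD1 v) //= dv mulN1r opprD addrA subrr sub0r oppr_le0 sumr_ge0 //.
apply/exists_inP; apply: contra_notT nS => /exists_inPn far.
apply: assembled_solve; apply: (@assembled_spread _ _ _ W) => //.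
  by apply: assembledS aW; apply: subsetUl.
move=> v vW; have /far : v \in ~: W by rewrite inE.
case/pred0Pn => e /andP[/= eE /imsetP[[a w]]]; rewrite !inE /=.
by move=> /andP[/eqP -> wW] ee; exists w; rewrite // inE -ee eE orbT.
Qed.

End Bound.
End Attempts.

(** * The limit criterion *)

Section Estimates.
Variable R : realType.
Implicit Types (x p : R).

Lemma expRN_le x : 0 <= x -> expR (- x) <= (1 + x)^-1.
Proof.
move=> x0; rewrite expRN lef_pV2 ?posrE ?expR_gt0 ?expR_ge1Dx //.
by rewrite ltr_wpDr.
Qed.

Lemma expR1_le4 : expR (1 : R) <= 4.
Proof.
have h : 2^-1 <= expR (- 2^-1) :> R.
  by apply: le_trans (expR_ge1Dx _); lra.
have e1 : expR 1 = (expR (- 2^-1) * expR (- 2^-1))^-1 :> R.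
  by rewrite -expRD -expRN; congr expR; lra.
rewrite e1 -[leRHS]invrK lef_pV2 ?posrE ?mulr_gt0 ?expR_gt0 ?invr_gt0 //.
have -> : 4^-1 = 2^-1 * 2^-1 :> R by lra.
by rewrite ler_pM ?invr_ge0.
Qed.

(** A crude Stirling bound; the induction step is (1 + 1/n)^n <= e <= 4. *)
Lemma expn_le_fact n : n%:R ^+ n <= 4 ^+ n * (n`!)%:R :> R.
Proof.
elim: n => [|n IH]; first by rewrite !expr0 mul1r.
have [->|n0] := posnP n; first by rewrite !expr1 mulr1; lra.
have n0R : 0 < n%:R :> R by rewrite ltr0n.
have h : (n.+1%:R) ^+ n <= 4 * n%:R ^+ n :> R.
  have -> : n.+1%:R = (1 + n%:R^-1) * n%:R :> R.
    by rewrite mulrDl mul1r mulVf ?gt_eqF // -natr1 addrC.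
  rewrite exprMn ler_wpM2r ?exprn_ge0 ?ler0n //; apply: le_trans expR1_le4.
  have e1 : n%:R^-1 * n%:R = 1 :> R by rewrite mulVf ?gt_eqF.
  rewrite -[X in expR X]e1 expRM_natr.
  by apply: lerXn2r; rewrite ?nnegrE ?expR_ge0 ?addr_ge0 ?invr_ge0 ?ler0n // ?expR_ge1Dx.
rewrite exprS (le_trans (ler_wpM2l (ler0n _ _) h)) // factS natrM.
have := ler_wpM2l (ler0n R n.+1) IH; rewrite [4 ^+ n.+1]exprS.
move: (n.+1%:R : R) (n%:R ^+ n : R) (4 ^+ n : R) (n`!%:R : R) => a b c d; nra.
Qed.

Lemma prod_ge1N (I : Type) (s : seq I) (a : I -> R) :
  (forall i, 0 <= a i <= 1) -> 1 - \sum_(i <- s) a i <= \prod_(i <- s) (1 - a i).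
Proof.
move=> a01; have [] : 1 - \sum_(i <- s) a i <= \prod_(i <- s) (1 - a i) /\
    \prod_(i <- s) (1 - a i) <= 1; last by [].
elim: s => [|i s [IH1 IH2]]; first by rewrite !big_nil; lra.
have p0 : 0 <= \prod_(j <- s) (1 - a j).
  by apply: prodr_ge0 => j _; rewrite subr_ge0; case/andP: (a01 j).
rewrite !big_cons; case/andP: (a01 i) => a0 a1.
move: (\prod_(j <- s) _) (\sum_(j <- s) _) IH1 IH2 p0 => x y; nra.
Qed.

Section RunProb.
Variable p : R.
Hypothesis p01 : 0 <= p <= 1.

Lemma exp1B_le k : (1 - p) ^+ k <= expR (- (p * k%:R)).
Proof.
case/andP: p01 => p0 p1; rewrite -mulNr expRM_natr.
by apply: lerXn2r; rewrite ?nnegrE ?subr_ge0 ?expR_ge0 // expR_ge1Dx.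
Qed.

(** From size [a] on, each step fails with probability at most exp(-p m a), so a union bound over
    the steps suffices. *)
Lemma run_prob_tail m a b : (a <= b)%N ->
  1 - (b - a)%:R * expR (- (p * (m * a)%:R)) <= run_prob p m a b.
Proof.
move=> ab; case/andP: (p01) => p0 p1.
have q01 k : 0 <= (1 - p) ^+ k <= 1.
  by rewrite exprn_ge0 ?exprn_ile1 // ?subr_ge0 // lerBlDr lerDl.
apply: le_trans (prod_ge1N _ (fun k => q01 (m * k)%N)).
rewrite lerD2l lerN2 mulr_natl -sumr_const_nat.
apply: ler_sum_nat => k /andP[ak _]; apply: le_trans (exp1B_le _) _.
by rewrite ler_expR lerN2 ler_wpM2l // ler_nat leq_mul2l ak orbT.
Qed.

(* With x = exp(-1/l), the factors 1 - x^k are at least k/(2l) for k <= l, where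
   l^l <= 4^l l! applies, and at least exp(-2 x^k) for k > l. *)
Lemma run_prob_ge m l K : (0 < l)%N -> l%:R^-1 <= p * m%:R ->
  expR (- (5 * l%:R)) <= run_prob p m 1 K.
Proof.
move=> l0 hl; case/andP: (p01) => p0 p1.
have l0R : 0 < l%:R :> R by rewrite ltr0n.
set x := expR (- l%:R^-1 : R).
have x0 : 0 <= x by exact: expR_ge0.
have x1 : x <= 1 by rewrite -expR0 ler_expR oppr_le0 invr_ge0 ltW.
have xk01 k : 0 <= x ^+ k <= 1 by rewrite exprn_ge0 // exprn_ile1.
have qx k : 1 - x ^+ k <= 1 - (1 - p) ^+ (m * k).
  rewrite lerD2l lerN2; apply: le_trans (exp1B_le _) _.
  rewrite /x -expRM_natr ler_expR natrM mulrA mulNr lerN2.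
  by rewrite ler_wpM2r.
have u01 k : 0 <= 1 - x ^+ k <= 1.
  by case/andP: (xk01 k) => h h'; rewrite subr_ge0 h' lerBlDr lerDl.
(* The range is extended so that it can be split after [l] even when K <= l; the added factors are
   at most 1. *)
apply: (@le_trans _ _ (\prod_(1 <= k < l.+1 + K) (1 - x ^+ k))); last first.
  apply: (@le_trans _ _ (\prod_(1 <= k < K) (1 - x ^+ k))); last first.
    by apply: ler_prod => k _; rewrite qx; case/andP: (u01 k) => ->.
  have [->|K0] := posnP K.
    by rewrite [leRHS]big_geq // prodr_ile1.
  rewrite (big_cat_nat (n := K)) /=; [|by []|by rewrite leq_addl].
  by rewrite ler_piMr ?prodr_ge0 ?prodr_ile1 // => k _; case/andP: (u01 k).
rewrite (big_cat_nat (n := l.+1)) /=; [|by []|by rewrite leq_addr].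
(* The exponent 5 is 3 + 2: exp(-3 l) pays for the 2^l 4^l = 8^l lost in the first [l] factors, and
   exp(-2 l) for the tail, whose powers x^k sum to at most [l]. *)
have -> : expR (- (5 * l%:R)) = expR (- (3 * l%:R)) * expR (- (2 * l%:R)) :> R.
  by rewrite -expRD; congr expR; ring.
have inv2 : expR (- (1 : R)) <= 2^-1.
  by apply: le_trans (expRN_le ler01) _; rewrite lef_pV2 ?posrE //; lra.
apply: ler_pM; rewrite ?expR_ge0 //.
  apply: (@le_trans _ _ (\prod_(1 <= k < l.+1) (k%:R / (2 * l%:R)))); last first.
    rewrite !big_nat; apply: ler_prod => k /andP[k1 kl].
    rewrite divr_ge0 ?mulr_ge0 ?ler0n //=.
    have kl1 : k%:R / l%:R <= 1 :> R by rewrite ler_pdivrMr // mul1r ler_nat -ltnS.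
    have k0 : 0 <= k%:R / l%:R :> R by rewrite divr_ge0.
    have -> : x ^+ k = expR (- (k%:R / l%:R)).
      by rewrite /x -expRM_natr mulNr mulrC.
    have -> : k%:R / (2 * l%:R) = (k%:R / l%:R) / 2 :> R.
      by rewrite invfM [2^-1 * _]mulrC mulrA.
    move: (k%:R / l%:R) k0 kl1 => u u0 u1.
    rewrite lerBrDr -lerBrDl; apply: le_trans (expRN_le u0) _.
    rewrite -[leLHS]mul1r ler_pdivrMr; last by lra.
    nra.
  rewrite big_split /= prodr_const_nat subSS subn0 exprVn -natr_prod -fact_prod.
  rewrite ler_pdivlMr ?exprn_gt0 ?mulr_gt0 // exprMn.
  have e8 : expR (- (3 * l%:R)) * 8 ^+ l <= 1 :> R.
    rewrite -mulNr expRM_natr -exprMn exprn_ile1 ?mulr_ge0 ?expR_ge0 //.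
    have -> : - (3 : R) = - 1 * 3%:R by ring.
    rewrite expRM_natr; have := expR_ge0 (- 1 : R).
    move: (expR _) inv2 => z z1 z2.
    have -> : z ^+ 3 * 8 = (2 * z) ^+ 3 by rewrite exprMn; ring.
    by rewrite exprn_ile1 //; lra.
  apply: (@le_trans _ _ (expR (- (3 * l%:R)) * (2 ^+ l * (4 ^+ l * (l`!)%:R)))).
    by rewrite ler_wpM2l ?expR_ge0 // ler_wpM2l ?exprn_ge0 // expn_le_fact.
  rewrite mulrA mulrA -[_ * 2 ^+ l * 4 ^+ l]mulrA -exprMn.
  have -> : 2 * 4 = 8 :> R by ring.
  by rewrite ler_piMl.
have x2 : x ^+ l <= 2^-1.
  by rewrite /x -expRM_natr mulNr mulVf ?gt_eqF.
have geo a n : (1 - x) * (\sum_(a <= k < a + n) x ^+ k) = x ^+ a - x ^+ (a + n).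
  elim: n => [|n IH]; first by rewrite addn0 big_geq // mulr0 subrr.
  by rewrite addnS big_nat_recr ?leq_addr //= mulrDr IH exprS; ring.
(* The geometric tail is at most x^(l+1) / (1 - x), where x^l <= 1/2 and 1 - x >= 1/(2 l). *)
have sum_le : \sum_(l.+1 <= k < l.+1 + K) x ^+ k <= l%:R.
  have x1l : (2 * l%:R)^-1 <= 1 - x.
    have il0 : 0 <= l%:R^-1 :> R by rewrite invr_ge0 ltW.
    have il1 : l%:R^-1 <= 1 :> R by rewrite invf_le1 // ler1n.
    rewrite lerBrDr -lerBrDl; apply: le_trans (expRN_le il0) _.
    rewrite invfM; move: (l%:R^-1) il0 il1 => u u0 u1.
    rewrite -[leLHS]mul1r ler_pdivrMr; last by lra.
    nra.
  have gl := geo l.+1 K.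
  have : (2 * l%:R)^-1 * \sum_(l.+1 <= k < l.+1 + K) x ^+ k <= 2^-1.
    apply: (@le_trans _ _ ((1 - x) * \sum_(l.+1 <= k < l.+1 + K) x ^+ k)).
      by rewrite ler_wpM2r // sumr_ge0 // => k _; case/andP: (xk01 k).
    rewrite gl; apply: le_trans x2; rewrite exprS.
    case/andP: (xk01 (l.+1 + K)%N) => h _.
    case/andP: (xk01 l) => h' _.
    by rewrite lerBlDr ler_wpDr // ler_piMl.
  rewrite invfM -mulrA ler_pdivrMl ?mulr_gt0 // mulfV // ler_pdivrMl //.
  by rewrite mulr1.
apply: (@le_trans _ _ (expR (- (2 * \sum_(l.+1 <= k < l.+1 + K) x ^+ k)))).
  by rewrite ler_expR lerN2 ler_wpM2l.
rewrite mulr_sumr -sumrN expR_sum !big_nat.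
apply: ler_prod => k /andP[lk _]; rewrite expR_ge0 /=.
have xk2 : x ^+ k <= 2^-1.
  by apply: le_trans x2; apply: ler_wiXn2l => //; apply: ltnW.
case/andP: (xk01 k) => xk0 _; move: (x ^+ k) xk0 xk2 => u u0 u1.
apply: le_trans (expRN_le _) _; first by rewrite mulr_ge0.
rewrite -[leLHS]mul1r ler_pdivrMr; last by lra.
nra.
Qed.

End RunProb.
End Estimates.

(** * From finite bounds to convergence *)

Section Asymptotics.
Variable R : realType.

(* The people graph is the union of two independent graphs of density about
   p/2: the first one grows a cluster of size K, to which the second one joins
   every other vertex. *)
Lemma AE_solve_prob_ge (T : finType) (puz : rel T) (mu : R) mA K1 mB K M :
  let L := ln (#|T|%:R : R) in let D := max_degree puz in
  64 * (64 * 10) <= mu -> mu <= L -> (0 < D)%N ->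
  (D <= 32 * mA)%N -> (0 < K1 <= K)%N -> (K - K1 <= #|T|)%N ->
  4 * D%:R * L ^+ 2 <= K%:R ->
  6 * D%:R * L ^+ 2 <= (K1 * mB)%:R ->
  expR (L / 64) <= M%:R ->
  (forall u v, connect puz u v) -> attempts puz mA K1 mB K M [set: T] ->
  1 - 3 * expR (5 - L / 128) <= AE_solve_prob puz mu.
Proof.
move=> L D mu0 muL D0 mAD K1K KT KL mBL ML conn aM.
have [B BE] : exists B : R, B = 64 * 10 by eexists.
have B0 : 0 < B by rewrite BE; lra.
have L0 : B <= L by lra.
have N0 : (0 < #|T|)%N.
  by rewrite lt0n; apply/eqP => T0; move: L0; rewrite /L T0 ln0 //; lra.
have NL : #|T|%:R = expR L :> R by rewrite lnK // posrE ltr0n.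
have D1 : 1 <= D%:R :> R by rewrite ler1n.
rewrite /AE_solve_prob /scaled_p -/L -/D.
set p := mu / _.
have DL0 : 0 < D%:R * L by rewrite mulr_gt0 //; lra.
have p0 : 0 < p by rewrite divr_gt0 //; lra.
have p1 : p <= 1 by rewrite ler_pdivrMr // mul1r (le_trans muL) // ler_peMl //; lra.
(* This [q2] gives the union of the two graphs density exactly [p], and q2 >= q1. *)
set q1 := p / 2; set q2 := q1 / (1 - q1).
have q1_01 : 0 <= q1 <= 1 by rewrite /q1; lra.
have q1h : q1 <= 1 - q1 by rewrite /q1; lra.
have q10 : 0 < 1 - q1 by rewrite /q1; lra.
have q2_01 : 0 <= q2 <= 1.
  by rewrite /q2 ler_pdivrMr // mul1r q1h divr_ge0 //; lra.
have q12 : q1 <= q2.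
  rewrite /q2 ler_pdivlMr // ger_pMr /q1; lra.
have pE : p = q1 + q2 - q1 * q2.
  have -> : q1 + q2 - q1 * q2 = q1 + q2 * (1 - q1) by ring.
  by rewrite /q2 divfK ?gt_eqF // /q1; lra.
have qDL : q1 * (D%:R * L) = mu / 2.
  by rewrite /q1 /p mulrAC divfK ?gt_eqF.
rewrite pE; apply: le_trans (solve_prob_bound q1_01 q2_01 K1K conn aM).
(* [d] bounds the failure probability of the second stage, of the sprinkling and of all attempts
   together; the end is (1 - d)^3 >= 1 - 3 d. *)
set d := expR (5 - L / 128).
have dL : expR (- L) <= d by rewrite ler_expR; lra.
have d1 : d <= 1 by rewrite -expR0 ler_expR; lra.
have d0 : 0 <= d by exact: expR_ge0.
have h1 : 1 - d <= run_prob q1 mB K1 K.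
  case/andP: (K1K) => _ /(run_prob_tail q1_01 mB); apply: le_trans.
  rewrite lerD2l lerN2; apply: le_trans dL.
  apply: (@le_trans _ _ (expR L * expR (- (2 * L)))); last first.
    by rewrite -expRD ler_expR; lra.
  rewrite ler_pM ?ler0n ?expR_ge0 //; first by rewrite -NL ler_nat.
  rewrite ler_expR lerN2 mulnC.
  apply: (@le_trans _ _ (q1 * (6 * D%:R * L ^+ 2))); last first.
    by rewrite ler_wpM2l //; case/andP: q1_01.
  have -> : q1 * (6 * D%:R * L ^+ 2) = 6 * L * (q1 * (D%:R * L)) by ring.
  by rewrite qDL; nra.
have h2 : 1 - d <= 1 - #|T|%:R * (1 - q2) ^+ K.
  rewrite lerD2l lerN2; apply: le_trans dL.
  apply: (@le_trans _ _ (expR L * expR (- (2 * L)))); last first.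
    by rewrite -expRD ler_expR; lra.
  rewrite NL ler_wpM2l ?expR_ge0 //; apply: le_trans (exp1B_le q2_01 _) _.
  rewrite ler_expR lerN2.
  apply: (@le_trans _ _ (q1 * (4 * D%:R * L ^+ 2))); last first.
    by rewrite ler_pM //; [case/andP: q1_01 | by rewrite mulr_ge0 ?sqr_ge0 // mulr_ge0].
  have -> : q1 * (4 * D%:R * L ^+ 2) = 4 * L * (q1 * (D%:R * L)) by ring.
  by rewrite qDL; nra.
set r := run_prob q1 mA 1 K1.
have r_01 : 0 <= r <= 1 by rewrite run_prob_ge0 ?run_prob_le1.
have h3 : 1 - d <= 1 - (1 - r) ^+ M.
  rewrite lerD2l lerN2; apply: le_trans (exp1B_le r_01 _) _.
  (* With [l] about L/640, a run succeeds with probability at least exp(-5 l) >= exp(-L/128 - 5), so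
     that exp(L/64) attempts contain at least exp(L/128 - 5) expected successes. *)
  pose l := (Num.trunc (L / B)).+1.
  have L640 : 0 <= L / B by rewrite divr_ge0 ?ltW //; lra.
  have l1 : L / B <= l%:R.
    by have := truncnS_gt (L / B); rewrite /l; exact: ltW.
  have l2 : l%:R <= L / B + 1.
    by rewrite /l -natr1 lerD2r truncn_le.
  have lq : l%:R^-1 <= q1 * mA%:R.
    have qm0 : 0 < q1 * mA%:R.
      rewrite mulr_gt0 //; first by rewrite /q1; lra.
      by rewrite ltr0n lt0n; apply/eqP => m0; move: mAD; rewrite m0 muln0 leqNgt D0.
    rewrite invf_ple ?posrE ?ltr0n //.
    apply: le_trans l1.
    have Dm : D%:R <= 32 * mA%:R :> R by rewrite -natrM ler_nat.
    have qm : B <= q1 * mA%:R * L.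
      have : q1 * (D%:R * L) <= q1 * ((32 * mA%:R) * L).
        by rewrite ler_wpM2l // ?ler_wpM2r //; case/andP: q1_01 => //; lra.
      by rewrite qDL; lra.
    rewrite -[leLHS]mul1r ler_pdivrMr // mulrAC ler_pdivlMr // mul1r.
    by rewrite mulrC.
  have LB : L / B = L / 64 / 10 by rewrite BE invfM mulrA.
  have rl : expR (- (5 * l%:R)) <= r by apply: run_prob_ge.
  have rM : expR (L / 128 - 5) <= r * M%:R.
    apply: (@le_trans _ _ (expR (- (5 * l%:R)) * expR (L / 64))).
      by rewrite -expRD ler_expR; lra.
    by rewrite ler_pM ?expR_ge0.
  have rM0 : 0 < r * M%:R by apply: lt_le_trans rM; exact: expR_gt0.
  apply: le_trans (expRN_le (ltW rM0)) _.
  have -> : d = (expR (L / 128 - 5))^-1 by rewrite /d -expRN; congr expR; ring.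
  by rewrite lef_pV2 ?posrE ?expR_gt0 //; lra.
have k1 : (1 - d) * (1 - d) <= run_prob q1 mB K1 K * (1 - (1 - r) ^+ M).
  by apply: ler_pM => //; lra.
have k2 : (1 - d) * (1 - d) * (1 - d) <=
  run_prob q1 mB K1 K * (1 - (1 - r) ^+ M) * (1 - #|T|%:R * (1 - q2) ^+ K).
  by apply: ler_pM => //; nra.
apply: le_trans k2; nra.
Qed.

(** [ER_prob] is a probability only for a density in [0, 1]. This follows from [mu <= L] if the
    degree and the logarithm are positive; otherwise division by 0 returns 0. *)
Lemma AE_solve_prob_le1 (T : finType) (puz : rel T) (mu : R) :
  let L := ln (#|T|%:R : R) in
  0 <= mu -> mu <= L -> AE_solve_prob puz mu <= 1.
Proof.
move=> L mu0 muL; rewrite /AE_solve_prob ER_probE.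
have p01 : 0 <= scaled_p puz mu <= 1.
  have L0 : 0 <= L by apply: le_trans muL.
  rewrite /scaled_p -/L divr_ge0 ?mulr_ge0 ?ler0n //=.
  have [->|D0] := posnP (max_degree puz); first by rewrite mul0r invr0 mulr0 ler01.
  have [L00|Ln0] := eqVneq L 0; first by rewrite L00 mulr0 invr0 mulr0 ler01.
  rewrite ler_pdivrMr ?mul1r; last by rewrite mulr_gt0 ?ltr0n // lt_neqAle eq_sym Ln0.
  by apply: le_trans muL _; rewrite ler_peMl // ler1n.
rewrite -[leRHS](Esubset_cst (scaled_p puz mu) (vertex_pairs T)); apply: le_Esubset => // E _.
by case: asbool.
Qed.

Local Open Scope classical_set_scope.

Lemma AE_solve_prob_cvg (T : nat -> finType) (puz : forall n, rel (T n)) (mu : R) :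
  64 * (64 * 10) <= mu ->
  (forall A : nat, \forall n \near \oo, (2 ^ A <= #|T n|)%N) ->
  (\forall n \near \oo, exists mA K1 mB K M,
    let L := ln (#|T n|%:R : R) in let D := max_degree (puz n) in
    [/\ (0 < D <= 32 * mA)%N, (0 < K1 <= K)%N /\ (K - K1 <= #|T n|)%N,
      4 * D%:R * L ^+ 2 <= K%:R /\ 6 * D%:R * L ^+ 2 <= (K1 * mB)%:R,
      expR (L / 64) <= M%:R &
      (forall u v, connect (puz n) u v) /\ attempts (puz n) mA K1 mB K M [set: T n]%SET]) ->
  AE_solve_prob (puz n) mu @[n --> \oo] --> (1 : R).
Proof.
move=> mu0 cT gT.
have cL A : \forall n \near \oo, A <= ln (#|T n|%:R : R).
  have ln2 : 0 < ln (2 : R) by rewrite ln_gt0 // ltr1n.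
  pose a := (Num.trunc (A / ln 2)).+1.
  have aA : A <= a%:R * ln 2.
    rewrite -ler_pdivrMr //; have := truncnS_gt (A / ln 2).
    exact: ltW.
  near=> n; apply: (le_trans aA).
  have : (2 ^ a <= #|T n|)%N by near: n; apply: cT.
  rewrite -(ler_nat R) natrX mulr_natl -lnXn // => h.
  by rewrite ler_ln // ?posrE ?exprn_gt0 // (lt_le_trans _ h) // exprn_gt0.
apply/cvgrPdist_le => e e0.
have mu_ge0 : 0 <= mu by apply: le_trans mu0; rewrite mulr_ge0 ?ler0n.
near=> n.
have nL : mu <= ln (#|T n|%:R : R) by near: n; apply: cL.
(* This is 3 exp(5 - L/128) <= e solved for L. *)
have ne : 128 * (5 - ln (e / 3)) <= ln (#|T n|%:R : R) by near: n; apply: cL.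
have le1 := AE_solve_prob_le1 (puz n) mu_ge0 nL.
rewrite ger0_norm ?subr_ge0 //.
have [mA [K1 [mB [K [M [/andP[D0 mAD] [K1K KT] [KL mBL] ML [conn aM]]]]]]] :
  exists mA K1 mB K M,
    let L := ln (#|T n|%:R : R) in let D := max_degree (puz n) in
    [/\ (0 < D <= 32 * mA)%N, (0 < K1 <= K)%N /\ (K - K1 <= #|T n|)%N,
      4 * D%:R * L ^+ 2 <= K%:R /\ 6 * D%:R * L ^+ 2 <= (K1 * mB)%:R,
      expR (L / 64) <= M%:R &
      (forall u v, connect (puz n) u v) /\ attempts (puz n) mA K1 mB K M [set: T n]%SET].
  by near: n.
have := AE_solve_prob_ge mu0 nL D0 mAD K1K KT KL mBL ML conn aM.
rewrite lerBlDr -lerBlDl => /le_trans; apply.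
have e3 : 0 < e / 3 by rewrite divr_gt0.
rewrite -ler_pdivlMl // [_ * e]mulrC -[leRHS]lnK ?posrE // ler_expR.
by lra.
Unshelve. all: by end_near.
Qed.

End Asymptotics.

(** * Exploration schemes *)

Section Growable.
Variables (T : finType) (puz : rel T) (m : nat).
Implicit Types (X Y W S B : {set T}).

(* l steps of growth from S that reveal no vertex outside Y, whatever else is
   fresh. *)
Definition growable l S Y := forall Q (Post : {set T} -> {set T} -> Prop) X W,
  S \subset W -> [disjoint X & W] -> Y \subset X ->
  (forall X', X :\: Y \subset X' -> Q X') ->
  (forall X' W', X :\: Y \subset X' -> [disjoint X' & W'] -> W \subset W' ->
     W' \subset W :|: Y -> #|W'| = (#|W| + l)%N -> Post X' W') ->
  grow puz m Q Post l X W.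

Lemma growable0 S Y : growable 0 S Y.
Proof.
move=> Q Post X W _ dXW _ _ PP; apply: PP; rewrite ?subsetDl ?addn0 //.
exact: subsetUl.
Qed.

Lemma growableS l S Y Y' : Y \subset Y' -> growable l S Y -> growable l S Y'.
Proof.
move=> sY gY Q Post X W sW dXW sX Qs Ps; apply: gY => //.
- exact: subset_trans sX.
- by move=> X' sX'; apply: Qs; apply: subset_trans sX'; apply: setDS.
- move=> X' W' sX' d s1 s2; apply: Ps => //.
    by apply: subset_trans sX'; apply: setDS.
  by apply: subset_trans s2 _; apply: setUS.
Qed.

Lemma growable_step l S B (Y : {set T}) (Y' : T -> {set T}) :
  B \subset Y -> (m <= #|B|)%N ->
  (forall b, b \in B -> exists2 w, w \in S & puz b w) ->
  (forall b, b \in B -> Y' b \subset Y :\: B /\ growable l (b |: S) (Y' b)) ->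
  growable l.+1 S Y.
Proof.
move=> sB mB pB gB Q Post X W sW dXW sX Qs Ps; exists B; split => //.
- exact: subset_trans sX.
- by apply: Qs; apply: setDS.
move=> b bB; split; first by have [w /(subsetP sW)] := pB b bB; exists w.
have [sY' gb] := gB b bB.
have bX : b \in X by rewrite (subsetP sX) // (subsetP sB).
have sXB X' : X :\: B :\: Y' b \subset X' -> X :\: Y \subset X'.
  apply: subset_trans; rewrite setDDl; apply: setDS; rewrite subUset sB.
  by apply: subset_trans sY' _; apply: subsetDl.
apply: gb.
- exact: setUS.
- rewrite disjoint_sym disjoints_subset subUset sub1set !inE bB /=.
  rewrite -disjoints_subset disjoint_sym; apply: disjointWl dXW; exact: subsetDl.
- by apply: subset_trans sY' _; apply: setSD.
- by move=> X' /sXB; apply: Qs.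
move=> X' W' /sXB sX' d s1 s2 cW; apply: Ps => //.
- by apply: subset_trans s1; apply: subsetUr.
- apply: subset_trans s2 _; rewrite !subUset sub1set inE (subsetP sB) // orbT subsetUl /=.
  apply: subset_trans sY' _; exact: subset_trans (subsetDl _ _) (subsetUr _ _).
- by rewrite cW cardsU1 (disjointFr dXW bX) add1n addSnnS.
Qed.

Lemma growable_cat l1 l2 S1 S2 Y1 Y2 : [disjoint Y1 & Y2] ->
  growable l1 S1 Y1 -> growable l2 S2 Y2 ->
  growable (l1 + l2) (S1 :|: S2) (Y1 :|: Y2).
Proof.
move=> dY g1 g2 Q Post X W; rewrite !subUset => /andP[sW1 sW2] dXW /andP[sX1 sX2] Qs Ps.
apply: grow_trans; apply: g1 => //.
  by move=> X' s; apply: Qs; apply: subset_trans s; apply: setDS; apply: subsetUl.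
move=> X' W' s d s1 s2 cW; apply: g2 => //.
- exact: subset_trans sW2 s1.
- apply: subset_trans s; apply/subsetP => x x2; rewrite inE (subsetP sX2) //.
  by rewrite (disjointFl dY x2).
- move=> X'' s'; apply: Qs; apply: subset_trans s'; rewrite -setDDl.
  exact: setSD.
move=> X'' W'' s' d' s1' s2' cW'; apply: Ps => //.
- by apply: subset_trans s'; rewrite -setDDl; apply: setSD.
- exact: subset_trans s1'.
- by apply: subset_trans s2' _; rewrite setUA; apply: setSU.
- by rewrite cW' cW addnA.
Qed.

Lemma growable_bigcup l (Z : T -> {set T}) S :
  {in S &, forall u v, u != v -> [disjoint Z u & Z v]} ->
  {in S, forall u, growable l [set u] (Z u)} ->
  growable (#|S| * l) S (\bigcup_(u in S) Z u).
Proof.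
elim/set_ind: S => [|u S uS IH] dZ gZ.
  by rewrite cards0; apply: growable0.
rewrite cardsU1 uS mulnDl mul1n big_setU1 //=; apply: growable_cat.
- rewrite disjoint_sym disjoints_subset; apply/bigcupsP => v vS.
  rewrite -disjoints_subset; apply: dZ; rewrite ?inE ?eqxx ?vS ?orbT //.
  by apply: contraNneq uS => <-.
- by apply: gZ; rewrite !inE eqxx.
- apply: IH; [move=> a b aS bS|move=> a aS].
    by apply: dZ; rewrite inE ?aS ?bS orbT.
  by apply: gZ; rewrite inE aS orbT.
Qed.

(** The adversary decides which [l1] vertices of [Y] join, so a territory [Z u] is set aside for
    every [u] in [Y]; each vertex that did join then makes its own run of [l2] steps. *)
Lemma growable_comb l1 l2 (Z : T -> {set T}) S Y :
  growable l1 S Y ->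
  {in Y &, forall u v, u != v -> [disjoint Z u & Z v]} ->
  {in Y, forall u, [disjoint Y & Z u]} ->
  {in Y, forall u, growable l2 [set u] (Z u)} ->
  growable (l1 + l1 * l2) S (Y :|: \bigcup_(u in Y) Z u).
Proof.
move=> gY dZ dYZ gZ Q Post X W sSW dXW; rewrite subUset => /andP[sXY sXZ] Qs Ps.
apply: grow_trans; apply: gY => //.
  by move=> X' s; apply: Qs; apply: subset_trans s; apply: setDS; apply: subsetUl.
move=> X' W' s d s1 s2 cW.
pose N := W' :\: W.
have NY : N \subset Y by rewrite subDset.
have cN : #|N| = l1 by rewrite cardsD (setIidPr s1) cW addKn.
have sNZ : \bigcup_(u in N) Z u \subset \bigcup_(u in Y) Z u.
  by apply/bigcupsP => u uN; apply: bigcup_sup; apply: (subsetP NY).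
have gN : growable (l1 * l2) N (\bigcup_(u in N) Z u).
  rewrite -cN; apply: growable_bigcup.
    by move=> a b aN bN; apply: dZ; apply: (subsetP NY).
  by move=> a aN; apply: gZ; apply: (subsetP NY).
have sXX' : X :\: (Y :|: \bigcup_(u in Y) Z u) \subset X' :\: \bigcup_(u in N) Z u.
  rewrite -setDDl; apply: subset_trans (setSD _ s) _; exact: setDS.
apply: gN => //.
- exact: subsetDl.
- apply: subset_trans s; apply/subsetP => x xZ.
  rewrite inE (subsetP sXZ) ?(subsetP sNZ) // andbT.
  case/bigcupP: xZ => u uN xZ.
  by rewrite (disjointFl (dYZ u _) xZ) // (subsetP NY).
- by move=> X'' s'; apply: Qs; apply: subset_trans s'.
move=> X'' W'' s' d' s1' s2' cW'; apply: Ps => //.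
- exact: subset_trans s'.
- exact: subset_trans s1'.
- apply: subset_trans s2' _; rewrite subUset (subset_trans s2) /=.
    by apply: subset_trans sNZ _; rewrite setUA; apply: subsetUr.
  by apply: setUS; apply: subsetUl.
- by rewrite cW' cW addnA.
Qed.

(** All of [Y] is adjacent to [v] itself, so [Y] can be cut into batches in any way, whichever
    vertices join. *)
Lemma growable_star l v Y :
  (forall u, u \in Y -> puz u v) -> (l * m <= #|Y|)%N -> growable l [set v] Y.
Proof.
move=> pY; suff h S : v \in S -> (l * m <= #|Y|)%N -> growable l S Y.
  by apply: h; rewrite inE.
elim: l S Y pY => [|l IH] S Y pY vS; first by move=> _; apply: growable0.
rewrite mulSn => lY.
have [B sB cB] : exists2 B : {set T}, B \subset Y & #|B| = m.
  exists [set x in take m (enum Y)].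
    by apply/subsetP => x; rewrite inE => /mem_take; rewrite mem_enum.
  rewrite cardsE (card_uniqP _) ?take_uniq ?enum_uniq // size_take -cardE.
  by move: lY; case: ltngtP; lia.
apply: (growable_step (Y' := fun=> Y :\: B) sB); rewrite ?cB //.
- by move=> b /(subsetP sB) /pY; exists v.
- move=> b bB; split=> //; apply: IH.
  + by move=> u; rewrite inE => /andP[_ /pY].
  + by rewrite inE vS orbT.
  + by rewrite cardsD (setIidPr sB) cB; lia.
Qed.

(* From v, all the vertices of Y whose h-rank exceeds g v are still fresh, and a
   batch has ranks between g v and the next value of g. *)
Lemma growable_ranked (good : nat -> T -> Prop) (h g : T -> nat) Y :
  (forall j v, good j.+1 v -> exists B : {set T}, [/\ B \subset Y, (m <= #|B|)%N,
     {in B, forall b, [/\ puz b v, g v < h b & good j b]%N} &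
     {in B &, forall b b', h b' <= g b}%N]) ->
  forall l v, good l v -> growable l [set v] [set u in Y | (g v < h u)%N].
Proof.
move=> step l v; suff hS S : v \in S -> good l v ->
    growable l S [set u in Y | (g v < h u)%N].
  by apply: hS; rewrite inE.
elim: l v S => [|l IH] v S vS; first by move=> _; apply: growable0.
case/step => B [sB mB pB hB].
apply: (growable_step (B := B) (Y' := fun b => [set u in Y | (g b < h u)%N])) => //.
- by apply/subsetP => b bB; rewrite inE (subsetP sB) //; case: (pB b bB).
- by move=> b bB; exists v => //; case: (pB b bB).
move=> b bB; have [_ gh gb] := pB b bB; split; last by apply: IH; rewrite // !inE eqxx.
apply/subsetP => u; rewrite !inE => /andP[uY gu]; rewrite uY /=; apply/andP; split.
  by apply/negP => uB; have := hB b u bB uB; rewrite leqNgt gu.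
by apply: leq_trans gh _; apply: leq_trans (ltnW gu); apply: hB.
Qed.

(** The run already reaches the final size, so the second stage has no steps. *)
Lemma attempts_growable mB K v Y : v \notin Y ->
  growable K [set v] Y -> attempts puz m K.+1 mB K.+1 1 (v |: Y).
Proof.
move=> vY gY; exists v; rewrite ?inE ?eqxx //=.
have sY : Y \subset (v |: Y) :\ v by rewrite subsetD1 vY subsetUr.
apply: gY => //; first by rewrite disjoint_sym disjoints1 !inE eqxx.
by move=> *; rewrite /extendable subnn.
Qed.

End Growable.

(** * The criterion in integer form *)

Section Criterion.
Variable R : realType.
Local Open Scope classical_set_scope.

(** Only ln(Q + 1) <= Q is used. The loss is harmless, as [Q] is 1 or a small root of [n] in the
    applications. *)
Lemma ln_natr_le (N Q e : nat) : (0 < N)%N -> (N <= Q.+1 ^ e)%N ->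
  ln (N%:R : R) <= (e * Q)%:R.
Proof.
move=> N0 NQ; rewrite -[leRHS]expRK ler_ln ?posrE ?ltr0n ?expR_gt0 //.
apply: (@le_trans _ _ (Q.+1 ^ e)%:R); first by rewrite ler_nat.
rewrite mulnC natrM expRM_natr natrX; apply: lerXn2r; rewrite ?nnegrE ?expR_ge0 //.
by rewrite -natr1 addrC expR_ge1Dx.
Qed.

(* The logarithm of #|T| is at most e Q because #|T| <= (Q + 1)^e. *)
Lemma AE_solve_prob_cvg_nat (T : nat -> finType) (puz : forall n, rel (T n)) (mu : R) :
  64 * (64 * 10) <= mu ->
  (forall A : nat, \forall n \near \oo, (2 ^ A <= #|T n|)%N) ->
  (\forall n \near \oo, exists D mA K1 mB K M Q e,
    [/\ (0 < max_degree (puz n) <= D)%N /\ (D <= 32 * mA)%N,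
      (0 < K1 <= K)%N /\ (K - K1 <= #|T n|)%N,
      (#|T n| <= Q.+1 ^ e)%N /\ (#|T n| <= M ^ 64)%N,
      (4 * D * (e * Q) ^ 2 <= K)%N /\ (6 * D * (e * Q) ^ 2 <= K1 * mB)%N &
      (forall u v, connect (puz n) u v) /\ attempts (puz n) mA K1 mB K M [set: T n]%SET]) ->
  AE_solve_prob (puz n) mu @[n --> \oo] --> (1 : R).
Proof.
move=> mu0 cT gT; apply: AE_solve_prob_cvg => //; near=> n.
have [D [mA [K1 [mB [K [M [Q [e [[/andP[D0 DD] DmA] hK [NQ NM] [h4 h6] hc]]]]]]]]] :
  exists D mA K1 mB K M Q e,
    [/\ (0 < max_degree (puz n) <= D)%N /\ (D <= 32 * mA)%N,
      (0 < K1 <= K)%N /\ (K - K1 <= #|T n|)%N,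
      (#|T n| <= Q.+1 ^ e)%N /\ (#|T n| <= M ^ 64)%N,
      (4 * D * (e * Q) ^ 2 <= K)%N /\ (6 * D * (e * Q) ^ 2 <= K1 * mB)%N &
      (forall u v, connect (puz n) u v) /\ attempts (puz n) mA K1 mB K M [set: T n]%SET].
  by near: n.
have N1 : (2 ^ 0 <= #|T n|)%N by near: n; apply: cT.
have L0 : 0 <= ln (#|T n|%:R : R) by rewrite ln_ge0 // ler1n.
have LQ := ln_natr_le N1 NQ.
have bound c : c%:R * (max_degree (puz n))%:R * ln (#|T n|%:R : R) ^+ 2
    <= (c * D * (e * Q) ^ 2)%:R.
  rewrite natrM natrX [(c * D)%:R]natrM; apply: ler_pM; rewrite ?mulr_ge0 ?ler0n ?exprn_ge0 //.
    by rewrite ler_wpM2l // ler_nat.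
  by apply: lerXn2r; rewrite ?nnegrE.
exists mA, K1, mB, K, M; split=> //.
- by rewrite D0 (leq_trans DD).
- by split; [apply: le_trans (bound 4) _|apply: le_trans (bound 6) _]; rewrite ler_nat.
have M0 : (0 < M)%N by case: M NM {hc} => //; rewrite exp0n // leqNgt N1.
have M0R : 0 < M%:R :> R by rewrite ltr0n.
rewrite -[leRHS]lnK ?posrE // ler_expR ler_pdivrMr // mulr_natr -lnXn // -natrX.
by rewrite ler_ln ?posrE ?ltr0n ?expn_gt0 ?M0 // ler_nat.
Unshelve. all: by end_near.
Qed.

End Criterion.

Lemma nat_root k n : (0 < k)%N -> exists Q, (Q ^ k <= n < Q.+1 ^ k)%N.
Proof.
move=> k0; elim: n => [|n [Q /andP[h1 h2]]].
  by exists 0%N; rewrite exp0n // exp1n.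
have [h|h] := leqP (Q.+1 ^ k) n.+1; last by exists Q; rewrite h (leq_trans h1).
exists Q.+1; rewrite h (leq_ltn_trans h2) // ltn_exp2r //.
Qed.

(** * Connectivity and degree bounds *)

Section Graphs.
Variables (T : finType) (puz : rel T).

Lemma connect_descent (h : T -> nat) (root : T) : symmetric puz ->
  (forall v, v != root -> exists2 u, puz v u & (h u < h v)%N) ->
  forall u v, connect puz u v.
Proof.
move=> sp step; have toroot v : connect puz v root.
  have [k] := ubnP (h v); elim: k v => // k IH v hv.
  have [->//|/step[u vu hu]] := eqVneq v root.
  by apply: connect_trans (connect1 vu) (IH _ _); apply: leq_trans hu _.
move=> u v; apply: connect_trans (toroot u) _.
by rewrite (sym_connect_sym sp).
Qed.

Lemma max_degree_bounds (I : finType) (f : T -> I -> T) :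
  (forall v w, puz v w -> exists i, w = f v i) ->
  (max_degree puz <= #|I|)%N.
Proof.
move=> pf; apply/bigmax_leqP => v _; apply: (@leq_trans #|[set f v i | i : I]|).
  apply: subset_leq_card; apply/subsetP => w; rewrite inE => /pf[i ->].
  exact: imset_f.
exact: leq_trans (leq_imset_card _ _) (max_card _).
Qed.

Lemma max_degree_gt0 v w : puz v w -> (0 < max_degree puz)%N.
Proof.
move=> vw; apply: leq_trans (leq_bigmax v); apply/card_gt0P; exists w.
by rewrite inE.
Qed.

End Graphs.

Definition upd (d : nat) (A : eqType) (v : {ffun 'I_d -> A}) (i : 'I_d) (a : A) :
  {ffun 'I_d -> A} := [ffun j => if j == i then a else v j].

Lemma upd_inj d (A : eqType) (v : {ffun 'I_d -> A}) i i' a a' :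
  a != v i -> upd v i a = upd v i' a' -> i = i' /\ a = a'.
Proof.
move=> av /ffunP/(_ i); rewrite !ffunE eqxx; case: eqVneq => [->//|_] e.
by rewrite e eqxx in av.
Qed.

(** * The torus and the range-r graph *)

Section CyclicDistance.
Variable n : nat.
Implicit Types a b : 'I_n.

(** With truncated subtraction, (a - b) + (b - a) is the absolute difference; removing the
    reductions modulo [n] makes linear arithmetic applicable. *)
Lemma cyc_distE a b :
  cyc_dist a b = minn ((a - b) + (b - a)) (n - ((a - b) + (b - a))).
Proof.
rewrite /cyc_dist; have := ltn_ord a; have := ltn_ord b.
move: (nat_of_ord a) (nat_of_ord b) => x y yn xn.
case: (ltnP x y) => [xy|]; last rewrite leq_eqVlt => /orP[/eqP ->|yx].
- have -> : (y + (n - x) = (y - x) + n)%N by lia.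
  by rewrite modnDr !modn_small; lia.
- have -> : (x + (n - x) = n)%N by lia.
  by rewrite modnn; lia.
- have -> : (x + (n - y) = (x - y) + n)%N by lia.
  by rewrite modnDr !modn_small; lia.
Qed.

Lemma cyc_distC a b : cyc_dist a b = cyc_dist b a.
Proof. by rewrite /cyc_dist minnC. Qed.

End CyclicDistance.

Section Torus.
Variables (d n : nat).
Hypothesis d_gt0 : (0 < d)%N.
Hypothesis n_gt0 : (0 < n)%N.
Local Notation vertex := {ffun 'I_d -> 'I_n.+1}.
Local Notation adj := (@torus_adj d n.+1).
Implicit Types (u v w : vertex).

Lemma torus_adj_sym : symmetric adj.
Proof. by move=> u v; congr (_ == _); apply: eq_bigr => i _; apply: cyc_distC. Qed.

Lemma torus_adj_upd v i (a : 'I_n.+1) : a = (v i).+1 :> nat \/ v i = a.+1 :> nat ->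
  adj (upd v i a) v.
Proof.
move=> av; rewrite /torus_adj (bigD1 i) //= big1 ?addn0.
  by rewrite ffunE eqxx cyc_distE; apply/eqP; move: (nat_of_ord a) (nat_of_ord (v i)) av => x y; lia.
by move=> j /negPf ji; rewrite ffunE ji cyc_distE !subnn min0n.
Qed.

Lemma torus_connected u v : connect adj u v.
Proof.
apply: (@connect_descent _ _ (fun v : vertex => \sum_i v i)%N [ffun=> ord0]).
  exact: torus_adj_sym.
move=> w w0; have [i wi] : exists i, w i != ord0.
  apply/existsP; apply: contraR w0; rewrite negb_exists => /forallP w0.
  by apply/eqP/ffunP => i; rewrite ffunE; apply/eqP; rewrite -[_ == _]negbK w0.
have wi0 : (0 < w i)%N by rewrite lt0n.
have wn : ((w i).-1 < n.+1)%N by have := ltn_ord (w i); lia.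
exists (upd w i (inord (w i).-1)).
  by rewrite torus_adj_sym torus_adj_upd //; right; rewrite inordK // prednK.
rewrite [ltnLHS](bigD1 i) //= [ltnRHS](bigD1 i) //= ffunE eqxx inordK // -addSn.
apply: leq_add; first by rewrite prednK.
by apply: leq_sum => j /negPf ji; rewrite ffunE ji.
Qed.

Lemma torus_max_degree : (0 < max_degree adj <= 2 * d)%N.
Proof.
apply/andP; split.
  pose i0 := Ordinal d_gt0.
  apply: (@max_degree_gt0 _ _ (upd [ffun=> ord0] i0 (inord 1)) [ffun=> ord0]).
  by apply: torus_adj_upd; left; rewrite inordK // ffunE.
pose f v (p : 'I_d * bool) := upd v p.1
  (inord (if p.2 then if (v p.1 == n :> nat) then 0%N else (v p.1).+1
    else if (v p.1 == 0 :> nat)%N then n else (v p.1).-1)).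
have -> : (2 * d)%N = #|{: 'I_d * bool}| by rewrite card_prod card_ord card_bool mulnC.
apply: (max_degree_bounds (f := f)) => v w /eqP sum1.
have [i di] : exists i, cyc_dist (v i) (w i) != 0%N.
  apply/existsP; move/eqP: sum1; apply: contraTT; rewrite negb_exists => /forallP h.
  by rewrite big1 // => i _; apply/eqP; rewrite -[_ == _]negbK h.
move: sum1; rewrite (bigD1 i) //= => sum1.
have wj j : j != i -> w j = v j.
  move=> ji; have : cyc_dist (v j) (w j) = 0%N.
    move: di sum1; rewrite (bigD1 j) //=.
    by move: (cyc_dist _ _) (cyc_dist _ _) (\sum_(_ | _) _)%N => x y z; lia.
  rewrite cyc_distE => h; apply/val_inj => /=; move: h (ltn_ord (v j)) (ltn_ord (w j)).
  by move: (nat_of_ord (v j)) (nat_of_ord (w j)) => x y; lia.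
have d1 : cyc_dist (v i) (w i) = 1%N.
  by move: di sum1; move: (cyc_dist _ _) (\sum_(_ | _) _)%N => x y; lia.
have vn := ltn_ord (v i); have wn := ltn_ord (w i).
have [b wb] : exists b, w i = inord (if b then if (v i == n :> nat) then 0%N else (v i).+1
    else if (v i == 0 :> nat)%N then n else (v i).-1).
  move: d1; rewrite cyc_distE => d1.
  pose b := ((w i == (v i).+1 :> nat) || ((v i == n :> nat) && (w i == 0 :> nat)))%N.
  exists b; apply/val_inj; rewrite /= inordK {}/b; move: d1 vn wn.
    move: (nat_of_ord (v i)) (nat_of_ord (w i)) => x y d1 xn yn.
    by repeat (case: eqP => //= ?); lia.
  move: (nat_of_ord (v i)) (nat_of_ord (w i)) => x y d1 xn yn.
  by repeat (case: eqP => //= ?); lia.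
exists (i, b); apply/ffunP => j; rewrite ffunE /=.
by case: (eqVneq j i) => [->|/wj].
Qed.

(** In a cube of side [s], a run starts at the lowest corner and raises one coordinate by 1 per
    step, so s - 1 steps stay inside. The [d] candidates all have the next coordinate sum, so no
    vertex is tested twice. *)
Lemma torus_attempts s mB : (0 < s)%N ->
  attempts adj d s mB s ((n.+1 %/ s) ^ d) [set: vertex].
Proof.
move=> s0; set q := (n.+1 %/ s)%N.
have qs : (q * s <= n.+1)%N by apply: leq_trunc_div.
pose box (z : {ffun 'I_d -> 'I_q}) : {set vertex} :=
  [set u : vertex | [forall i, (z i * s <= u i < (z i).+1 * s)%N]].
pose base (z : {ffun 'I_d -> 'I_q}) : vertex := [ffun i => inord (z i * s)].
have baseE z i : base z i = (z i * s)%N :> nat.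
  rewrite ffunE inordK //; apply: leq_trans qs; rewrite ltn_mul2r s0.
  exact: ltn_ord.
have -> : (q ^ d)%N = (#|{ffun 'I_d -> 'I_q}| * 1)%N by rewrite card_ffun !card_ord muln1.
apply: (attempts_family (Y := box)).
  move=> z z' zz'; rewrite -setI_eq0; apply: contraR zz' => /set0Pn[u].
  rewrite !inE => /andP[/forallP h /forallP h'].
  apply/eqP/ffunP => i; apply/val_inj => /=.
  have /andP[a b] := h i; have /andP[a' b'] := h' i.
  have l1 : (z i * s < (z' i).+1 * s)%N by apply: leq_ltn_trans b'.
  have l2 : (z' i * s < (z i).+1 * s)%N by apply: leq_ltn_trans b.
  by move: l1 l2; rewrite !ltn_mul2r s0 /= !ltnS => l1 l2; apply/eqP; rewrite eqn_leq l1.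
move=> z; pose h (u : vertex) := (\sum_i u i)%N.
pose good (j : nat) v := forall i, (z i * s <= v i /\ v i + j < (z i).+1 * s)%N.
pose Y := [set u in box z | (h (base z) < h u)%N].
have gY : growable adj d s.-1 [set base z] Y.
  apply: (growable_ranked (good := good)) => [j v gv|]; last first.
    by move=> i; rewrite baseE mulSn; move: (z i * s)%N => x; lia.
  have vi1 i : ((v i).+1 < n.+1)%N.
    have [_ h1] := gv i; have h2 : ((z i).+1 * s <= q * s)%N.
      by rewrite leq_mul2r (ltn_ord (z i)) orbT.
    apply: leq_trans qs; apply: leq_trans h2; apply: leq_ltn_trans h1.
    by rewrite addnS ltnS leq_addr.
  pose b i := upd v i (inord (v i).+1).
  have hb i : h (b i) = (h v).+1.
    rewrite /h (bigD1 i) //= ffunE eqxx inordK // (bigD1 i (P := predT)) //= addSn.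
    congr (_ + _).+1; apply: eq_bigr => k /negPf ki; by rewrite ffunE ki.
  have bE i k : b i k = (v k + (k == i))%N :> nat.
    by rewrite ffunE; case: eqVneq => [->|_]; rewrite ?inordK ?addn1 ?addn0.
  exists [set b i | i : 'I_d]; split.
  - apply/subsetP => _ /imsetP[i _ ->]; rewrite inE; apply/forallP => k.
    have [] := gv k; rewrite bE; move: (z k * s)%N ((z k).+1 * s)%N (nat_of_ord (v k)).
    by case: (k == i) => x y t; lia.
  - rewrite card_imset ?card_ord // => i i'.
    by case/upd_inj => //; apply/eqP => /(congr1 val) /=; rewrite inordK //; lia.
  - move=> _ /imsetP[i _ ->]; split.
    + by apply: torus_adj_upd; left; rewrite inordK.
    + by rewrite hb.
    + move=> k; have [] := gv k; rewrite bE; move: (z k * s)%N ((z k).+1 * s)%N (nat_of_ord (v k)).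
      by case: (k == i) => x y t; lia.
  - by move=> _ _ /imsetP[i _ ->] /imsetP[i' _ ->]; rewrite !hb.
rewrite -[s](prednK s0); apply: attemptsS (attempts_growable mB _ gY); last first.
  by rewrite inE ltnn andbF.
rewrite subUset sub1set; apply/andP; split; last by apply/subsetP => u; rewrite inE => /andP[].
by rewrite inE; apply/forallP => i; rewrite baseE mulSn leqnn -[ltnLHS]add0n ltn_add2r.
Qed.

End Torus.

Section TorusLimit.
Variable R : realType.
Local Open Scope classical_set_scope.

Lemma near_root k Q0 : (0 < k)%N ->
  \forall n \near \oo, exists Q, [/\ (Q0 <= Q)%N, (Q ^ k <= n)%N & (n < Q.+1 ^ k)%N].
Proof.
move=> k0; near=> n; have [Q /andP[h1 h2]] := nat_root n k0.
exists Q; split=> //; have : (Q0 ^ k <= n)%N by near: n; exact: nbhs_infty_ge.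
by move=> h; have := leq_ltn_trans h h2; rewrite ltn_exp2r // ltnS.
Unshelve. all: by end_near.
Qed.

Lemma near_card_ge (f : nat -> nat) : (forall n, (n <= f n)%N) ->
  forall A, \forall n \near \oo, (2 ^ A <= f n)%N.
Proof.
move=> fn A; near=> n; apply: leq_trans (fn n); near: n; exact: nbhs_infty_ge.
Unshelve. all: by end_near.
Qed.

Lemma torus_cvg (d : nat) (mu : R) : (0 < d)%N -> 64 * (64 * 10) <= mu ->
  AE_solve_prob (@torus_adj d n) mu @[n --> \oo] --> (1 : R).
Proof.
move=> d0 mu0; have cT n : #|{ffun 'I_d -> 'I_n}| = (n ^ d)%N.
  by rewrite card_ffun !card_ord.
apply: AE_solve_prob_cvg_nat => //.
  by apply: near_card_ge => n; rewrite cT; case: n => // n; rewrite -{1}(expn1 n.+1) leq_pexp2l.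
apply: filterS (near_root (512 * d ^ 3 + 2) (ltn0Sn 7)) => n [Q [Q0 Qn nQ]].
have Q2 : (2 <= Q)%N by apply: leq_trans Q0; rewrite leq_addl.
have s0 : (0 < Q ^ 4)%N by rewrite expn_gt0; lia.
have nQ16 : (n <= Q ^ 16)%N.
  apply: leq_trans (ltnW nQ) _; rewrite -[16%N]/(2 * 8)%N expnM leq_exp2r //.
  by rewrite -mulnn; nia.
have ns : (Q ^ 4 <= n %/ Q ^ 4)%N by rewrite leq_divRL // -expnD.
have n1 : (1 < n)%N.
  by apply: leq_trans Qn; apply: leq_trans Q2 _; rewrite -{1}(expn1 Q) leq_pexp2l //; lia.
have KQ : (512 * d ^ 3 * Q ^ 2 <= Q ^ 4)%N.
  rewrite -[4%N]/(2 + 2)%N expnD leq_mul2r; apply/orP; right.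
  by rewrite -mulnn; move: Q0 Q2; move: (512 * d ^ 3)%N => x; nia.
(* [Q] is about n^(1/8), so log N <= 8 d Q, and Q^4 exceeds 4 (2d) (8dQ)^2 = 512 d^3 Q^2. The batch
   size 2 covers the factor 6 in the second size condition. At least Q^(4d) cubes are available. *)
exists (2 * d)%N, d, (Q ^ 4)%N, 2%N, (Q ^ 4)%N, ((n %/ Q ^ 4) ^ d)%N, Q, (8 * d)%N.
have nQ8 := ltnW nQ.
rewrite cT; case: n {Qn nQ} n1 nQ16 ns nQ8 => // n n0 nQ16 ns nQ8.
split.
- by rewrite torus_max_degree //; split=> //; lia.
- by rewrite s0 leqnn subnn.
- split; first by rewrite expnM leq_exp2r.
  rewrite -expnM mulnC expnM leq_exp2r //.
  apply: leq_trans nQ16 _; apply: leq_trans (_ : (Q ^ 4) ^ 64 <= _)%N.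
    by rewrite -expnM leq_pexp2l //; lia.
  by rewrite leq_exp2r.
- move: KQ; rewrite !expnMn; move: (Q ^ 4)%N (Q ^ 2)%N => x y.
  rewrite -[3%N]/(1 + 2)%N expnD expn1; move: (d ^ 2)%N => z.
  rewrite -[(8 ^ 2)%N]/64%N => h; split; nia.
- by split; [exact: torus_connected|exact: torus_attempts].
Qed.

End TorusLimit.

(** * The range-r graph *)

Section RangeGraph.
Variables (r n : nat).
Hypothesis r_gt0 : (0 < r)%N.
Hypothesis rn : (r <= n)%N.
Local Notation vertex := {ffun 'I_2 -> 'I_n.+1}.
Local Notation adj := (@range_adj r n.+1).
Implicit Types (u v w : vertex).

Lemma torus_range_adj u v : @torus_adj 2 n.+1 u v -> adj u v.
Proof.
move=> /eqP uv; apply/andP; split.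
  apply/eqP => e; move: uv; rewrite e big1 // => i _.
  by rewrite cyc_distE !subnn min0n.
apply/bigmax_leqP => i _; apply: leq_trans r_gt0.
apply: (@leq_trans (\sum_i cyc_dist (u i) (v i))); last by rewrite uv.
by rewrite (bigD1 i) //= leq_addr.
Qed.

Lemma range_connected u v : connect adj u v.
Proof.
have n0 : (0 < n)%N by apply: leq_trans rn.
apply: (@connect_sub _ (@torus_adj 2 n.+1)); last exact: torus_connected.
by move=> x y /torus_range_adj; apply: connect1.
Qed.

(** [a] encodes the displacement a - r, and adding n + 1 - r avoids negative numbers. *)
Lemma cyc_dist_le (x y : 'I_n.+1) : (cyc_dist x y <= r)%N ->
  exists a : 'I_(2 * r).+1, y = inord ((x + a + (n.+1 - r)) %% n.+1).
Proof.
rewrite cyc_distE => h.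
have [a ra ay] : exists2 a, (a <= 2 * r)%N & ((x + a + (n.+1 - r)) %% n.+1 = y)%N.
  move: h (ltn_ord x) (ltn_ord y); move: (nat_of_ord x) (nat_of_ord y) => {}x {}y h xn yn.
  have [h1|h1] := leqP ((x - y) + (y - x)) r.
    exists (y + r - x)%N; first by lia.
    have -> : (x + (y + r - x) + (n.+1 - r) = y + n.+1)%N by lia.
    by rewrite modnDr modn_small.
  have [h2|h2] := leqP x y.
    exists (y + r - x - n.+1)%N; first by lia.
    have -> : (x + (y + r - x - n.+1) + (n.+1 - r) = y)%N by lia.
    by rewrite modn_small.
  exists (y + r + n.+1 - x)%N; first by lia.
  have -> : (x + (y + r + n.+1 - x) + (n.+1 - r) = y + n.+1 + n.+1)%N by lia.
  by rewrite !modnDr modn_small.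
have ra1 : (a < (2 * r).+1)%N by [].
by exists (Ordinal ra1); rewrite /= ay inord_val.
Qed.

Lemma range_max_degree : (0 < max_degree adj <= (2 * r).+1 ^ 2)%N.
Proof.
have n0 : (0 < n)%N by apply: leq_trans rn.
apply/andP; split.
  apply: (@max_degree_gt0 _ _ (upd [ffun=> ord0] ord0 (inord 1)) [ffun=> ord0]).
  by apply/torus_range_adj/torus_adj_upd => //; left; rewrite inordK // ffunE.
have -> : ((2 * r).+1 ^ 2)%N = #|{ffun 'I_2 -> 'I_(2 * r).+1}|.
  by rewrite card_ffun !card_ord.
apply: (max_degree_bounds
  (f := fun v (g : {ffun 'I_2 -> 'I_(2 * r).+1}) =>
     [ffun i => inord ((v i + g i + (n.+1 - r)) %% n.+1)])).
move=> v w /andP[_ /bigmax_leqP vw].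
have /fin_all_exists[g gP] : forall i, exists a : 'I_(2 * r).+1,
    w i = inord ((v i + a + (n.+1 - r)) %% n.+1).
  by move=> i; apply: cyc_dist_le; apply: vw.
by exists [ffun i => g i]; apply/ffunP => i; rewrite !ffunE.
Qed.

(** The first coordinate advances by more than r/2 and at most r, so two advances pass everything
    within reach of one and successive batches are disjoint. The second coordinate is free to wrap
    around. *)
Definition range_step v (p : 'I_(r - r./2) * 'I_r.+1) : vertex :=
  [ffun i => if i == ord0 then inord (v i + r./2 + p.1).+1
             else inord ((v i + p.2) %% n.+1)].

Lemma range_step_inj v : (v ord0 + r < n.+1)%N -> injective (range_step v).
Proof.
move=> vr [a c] [a' c'] /ffunP e.
have h2 := odd_double_half r.
have e0 := congr1 val (e ord0); have e1 := congr1 val (e ord_max).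
move: e0 e1; rewrite !ffunE /= => e0 e1.
have aE : a = a' :> nat.
  move: e0; rewrite !inordK; move: (ltn_ord a) (ltn_ord a') vr.
  - by move: (v ord0 : nat) (a : nat) (a' : nat) => x y z; lia.
  - by move: (v ord0 : nat) (a : nat) (a' : nat) => x y z; lia.
  - by move: (v ord0 : nat) (a : nat) (a' : nat) => x y z; lia.
have cE : c = c' :> nat.
  move: e1; rewrite !inordK ?ltn_mod // => /eqP; rewrite eqn_modDl.
  have ltc (d : 'I_r.+1) : (d < n.+1)%N by apply: leq_trans (ltn_ord d) _; rewrite ltnS.
  by rewrite !modn_small // => /eqP.
by congr (_, _); apply: val_inj.
Qed.

Lemma range_step_adj v p : (v ord0 + r < n.+1)%N -> adj (range_step v p) v.
Proof.
case: p => a c vr; have h2 := odd_double_half r.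
have b0 : (v ord0 + r./2 + a).+1 = range_step v (a, c) ord0 :> nat.
  rewrite ffunE /= inordK //; move: (ltn_ord a) vr.
  by move: (v ord0 : nat) (a : nat) => x y; lia.
apply/andP; split.
  apply/eqP => e; move: b0; rewrite e; move: (v ord0 : nat) => x; lia.
apply/bigmax_leqP => i _; rewrite cyc_distE.
have [->|i0] := eqVneq i ord0.
  rewrite -b0; move: (ltn_ord a) vr; move: (v ord0 : nat) (a : nat) => x y; lia.
rewrite ffunE (negPf i0) /= inordK ?ltn_mod //.
move: (ltn_ord c) (ltn_ord (v i)); move: (v i : nat) (c : nat) => x y yr xn.
have [h|h] := ltnP (x + y) n.+1; first by rewrite modn_small //; lia.
have -> : (x + y = (x + y - n.+1) + n.+1)%N by lia.
by rewrite modnDr modn_small; lia.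
Qed.

Lemma range_attempts s mB : (0 < s)%N ->
  attempts adj ((r - r./2) * r.+1) s mB s (n.+1 %/ (s * r)) [set: vertex].
Proof.
move=> s0; set wd := (s * r)%N; set q := (n.+1 %/ wd)%N.
have w0 : (0 < wd)%N by rewrite muln_gt0 s0.
have qs : (q * wd <= n.+1)%N by apply: leq_trunc_div.
pose strip (z : 'I_q) : {set vertex} :=
  [set u : vertex | (z * wd <= u ord0 < z.+1 * wd)%N].
pose base (z : 'I_q) : vertex := [ffun i => inord (z * wd)].
have baseE z i : base z i = (z * wd)%N :> nat.
  by rewrite ffunE inordK //; apply: leq_trans qs; rewrite ltn_mul2r w0 /=.
have -> : q = (#|'I_q| * 1)%N by rewrite card_ord muln1.
apply: (attempts_family (Y := strip)).
  move=> z z' zz'; rewrite -setI_eq0; apply: contraR zz' => /set0Pn[u].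
  rewrite !inE => /andP[/andP[a b] /andP[a' b']].
  have l1 : (z * wd < z'.+1 * wd)%N by apply: leq_ltn_trans b'.
  have l2 : (z' * wd < z.+1 * wd)%N by apply: leq_ltn_trans b.
  move: l1 l2; rewrite !ltn_mul2r w0 /= !ltnS => l1 l2.
  by apply/eqP/val_inj; apply/eqP; rewrite eqn_leq l1.
move=> z; pose h (u : vertex) := nat_of_ord (u ord0).
pose g (u : vertex) := (u ord0 + r./2)%N.
pose good (j : nat) v := (z * wd <= v ord0)%N /\ (v ord0 + j * r < z.+1 * wd)%N.
pose Y := [set u in strip z | (g (base z) < h u)%N].
have gY : growable adj ((r - r./2) * r.+1) s.-1 [set base z] Y.
  apply: (growable_ranked (good := good)) => [j v [g1 g2]|]; last first.
    rewrite /good baseE leqnn mulSn; split=> //.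
    by rewrite addnC ltn_add2r /wd ltn_mul2r r_gt0 prednK /=.
  have vr : (v ord0 + r < n.+1)%N.
    apply: leq_trans qs; apply: leq_trans (_ : (z.+1 * wd <= q * wd)%N); last first.
      by rewrite leq_mul2r (ltn_ord z) orbT.
    by apply: leq_ltn_trans g2; rewrite mulSn leq_add2l leq_addr.
  have h2 := odd_double_half r.
  have bE p : range_step v p ord0 = (v ord0 + r./2 + p.1).+1 :> nat.
    rewrite ffunE /= inordK //; move: (ltn_ord p.1) vr.
    by move: (v ord0 : nat) (p.1 : nat) => x y; lia.
  have bP (p : 'I_(r - r./2) * 'I_r.+1) : (v ord0 + r./2 + p.1 < v ord0 + r)%N.
    by have := ltn_ord p.1; move: (v ord0 : nat) (p.1 : nat) => x y; lia.
  exists [set range_step v p | p : 'I_(r - r./2) * 'I_r.+1]; split.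
  - apply/subsetP => _ /imsetP[p _ ->]; rewrite inE bE; move: (bP p) g1 g2; rewrite mulSn.
    move: (z * wd)%N (z.+1 * wd)%N (v ord0 : nat) (p.1 : nat) (j * r)%N => x y t k i.
    by lia.
  - by rewrite card_imset ?card_prod ?card_ord //; apply: range_step_inj.
  - move=> _ /imsetP[p _ ->]; split.
    + exact: range_step_adj.
    + rewrite /g /h bE ltnS leq_addr //.
    + rewrite /good bE; move: (bP p) g1 g2; rewrite mulSn.
      move: (z * wd)%N (z.+1 * wd)%N (v ord0 : nat) (p.1 : nat) (j * r)%N => x y t k i.
      by lia.
  - move=> _ _ /imsetP[p _ ->] /imsetP[p' _ ->]; rewrite /h /g !bE.
    by move: (bP p) (bP p'); move: (v ord0 : nat) (p.1 : nat) (p'.1 : nat) => x y t; lia.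
rewrite -[s](prednK s0); apply: attemptsS (attempts_growable mB _ gY); last first.
  by rewrite inE ltnNge /h /g leq_addr andbF.
rewrite subUset sub1set; apply/andP; split; last by apply/subsetP => u; rewrite inE => /andP[].
by rewrite inE baseE mulSn leqnn -[ltnLHS]add0n ltn_add2r.
Qed.

End RangeGraph.

Lemma range_degree_ratio r : (0 < r)%N ->
  ((2 * r).+1 ^ 2 <= 32 * ((r - r./2) * r.+1))%N.
Proof.
move=> r0; have h := odd_double_half r.
have h1 : ((2 * r).+1 <= 16 * (r - r./2))%N.
  by move: h; case: (odd r) => /=; move: (r./2) => x; lia.
have -> : (32 * ((r - r./2) * r.+1) = (16 * (r - r./2)) * (2 * r.+1))%N.
  by rewrite mulnACA.
by rewrite -mulnn; apply: leq_mul h1 _; lia.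
Qed.

Section RangeLimit.
Variable R : realType.
Local Open Scope classical_set_scope.

Lemma range_cvg (r : nat) (mu : R) : (0 < r)%N -> 64 * (64 * 10) <= mu ->
  AE_solve_prob (@range_adj r n) mu @[n --> \oo] --> (1 : R).
Proof.
move=> r0 mu0; have cT n : #|{ffun 'I_2 -> 'I_n}| = (n ^ 2)%N.
  by rewrite card_ffun !card_ord.
apply: AE_solve_prob_cvg_nat => //.
  by apply: near_card_ge => n; rewrite cT; case: n => // n; rewrite -{1}(expn1 n.+1) leq_pexp2l.
apply: filterS (near_root (1024 * (2 * r).+1 ^ 2) (ltn0Sn 7)) => n [Q [Q0 Qn nQ]].
have rQ : (r < Q)%N by apply: leq_trans Q0; rewrite -mulnn; nia.
have Q2 : (2 <= Q)%N by apply: leq_ltn_trans rQ.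
have s0 : (0 < Q ^ 4)%N by rewrite expn_gt0; lia.
have nQ16 : (n <= Q ^ 16)%N.
  apply: leq_trans (ltnW nQ) _; rewrite -[16%N]/(2 * 8)%N expnM leq_exp2r //.
  by rewrite -mulnn; nia.
have ns : (Q ^ 3 <= n %/ (Q ^ 4 * r))%N.
  have w0 : (0 < Q ^ 4 * r)%N by rewrite muln_gt0 s0 r0.
  rewrite leq_divRL //; apply: leq_trans Qn.
  by rewrite mulnA -expnD (expnSr Q 7) leq_mul2l (ltnW rQ) orbT.
have rn : (r < n)%N.
  by apply: leq_trans Qn; apply: leq_trans rQ _; rewrite -{1}(expn1 Q) leq_pexp2l //; lia.
have KQ : (1024 * (2 * r).+1 ^ 2 * Q ^ 2 <= Q ^ 4)%N.
  have -> : (Q ^ 4 = Q ^ 2 * Q ^ 2)%N by rewrite -expnD.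
  rewrite leq_mul2r; apply/orP; right.
  by apply: leq_trans Q0 _; rewrite -{1}(expn1 Q) leq_pexp2l //; lia.
(* Here log N <= 16 Q, so the size needed is 4 D (16 Q)^2 = 1024 D Q^2. Strips of width Q^4 r leave
   at least Q^3 attempts. *)
exists ((2 * r).+1 ^ 2)%N, ((r - r./2) * r.+1)%N, (Q ^ 4)%N, 2%N, (Q ^ 4)%N,
  (n %/ (Q ^ 4 * r))%N, Q, 16%N.
have nQ8 := ltnW nQ.
rewrite cT; case: n {Qn nQ} rn nQ16 ns nQ8 => // n rn nQ16 ns nQ8.
split.
- rewrite range_max_degree //; split=> //.
  exact: range_degree_ratio.
- by rewrite s0 leqnn subnn.
- split; first by rewrite -[16%N]/(8 * 2)%N expnM leq_exp2r.
  apply: leq_trans (_ : (Q ^ 3) ^ 64 <= _)%N; last by rewrite leq_exp2r.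
  apply: leq_trans (_ : (Q ^ 16) ^ 2 <= _)%N; first by rewrite leq_exp2r.
  by rewrite -!expnM leq_pexp2l //; lia.
- move: KQ; rewrite !expnMn; move: (Q ^ 4)%N (Q ^ 2)%N => x y.
  move: ((2 * r).+1 ^ 2)%N => z.
  rewrite -mulnA [(4 * z * _)%N]mulnACA [(6 * z * _)%N]mulnACA.
  move: (z * y)%N => t h; split; first exact: h.
  apply: (@leq_trans (1024 * t * 2)); last by rewrite leq_mul2r h orbT.
  by rewrite [(1024 * t * 2)%N]mulnAC leq_mul2r; apply/orP; right.
- by split; [exact: range_connected|exact: range_attempts].
Qed.

End RangeLimit.

(** * The hypercube and the Hamming graph *)

Section DifferInOne.
Variables (d : nat) (A : finType).
Local Notation vertex := {ffun 'I_d -> A}.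
Local Notation adj := (@differ_in_one d A).
Implicit Types (u v w : vertex).

Lemma differ_in_one_sym : symmetric adj.
Proof.
move=> u v; rewrite /differ_in_one; congr (_ == _).
by apply: eq_card => i; rewrite !inE eq_sym.
Qed.

Lemma differ_in_one_upd v i a : a != v i -> adj (upd v i a) v.
Proof.
move=> av; apply/cards1P; exists i; apply/setP => j; rewrite !inE ffunE.
by case: (eqVneq j i) => [->|_] //; rewrite eqxx.
Qed.

Lemma differ_in_oneP v w : adj v w -> exists i, w = upd v i (w i).
Proof.
rewrite /differ_in_one => /cards1P[i /setP vw]; exists i; apply/ffunP => j; rewrite ffunE.
have := vw j; rewrite !inE; case: (eqVneq j i) => [->//|_] /negbT.
by rewrite negbK => /eqP.
Qed.

Lemma differ_in_one_connected u v : connect adj u v.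
Proof.
pose h w := #|[set i | w i != v i]|.
apply: (@connect_descent _ _ h v); first exact: differ_in_one_sym.
move=> w wv; have [i wi] : exists i, w i != v i.
  apply/existsP; apply: contraR wv; rewrite negb_exists => /forallP e.
  by apply/eqP/ffunP => i; apply/eqP; rewrite -[_ == _]negbK e.
exists (upd w i (v i)).
  by rewrite differ_in_one_sym differ_in_one_upd // eq_sym.
apply: proper_card; apply/properP; split.
  apply/subsetP => j; rewrite !inE ffunE; case: (eqVneq j i) => [->|//].
  by rewrite eqxx.
by exists i; rewrite !inE // ffunE !eqxx.
Qed.

End DifferInOne.

(** * The hypercube *)

Section Hypercube.
Variables (q k l : nat).
Local Notation n := (4 * q + k)%N.
Local Notation vertex := {ffun 'I_n -> bool}.
Local Notation adj := (@hypercube_adj n).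
Implicit Types (u v w : vertex).

Lemma hypercube_max_degree p : (0 < p)%N ->
  (0 < max_degree (@hypercube_adj p) <= p)%N.
Proof.
move=> p0; apply/andP; split.
  pose i0 := Ordinal p0.
  apply: (@max_degree_gt0 _ _ (upd [ffun=> false] i0 true) [ffun=> false]).
  by apply: differ_in_one_upd; rewrite ffunE.
rewrite -[leqRHS]card_ord.
apply: (max_degree_bounds (f := fun (v : {ffun 'I_p -> bool}) i => upd v i (~~ v i))).
move=> v w vw; have [i e] := differ_in_oneP vw; exists i.
have : w != v.
  apply: contraTneq vw => ->; rewrite /hypercube_adj /differ_in_one.
  have -> : [set i | v i != v i] = finset.set0 by apply/setP => j; rewrite !inE eqxx.
  by rewrite cards0.
rewrite {1}e => wv; rewrite {1}e; congr upd.
have : w i != v i.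
  by apply: contraNneq wv => wi; apply/eqP/ffunP => j; rewrite ffunE; case: eqVneq => // ->.
by case: (w i); case: (v i).
Qed.

Definition ones r u := #|[set i : 'I_n | (r * q <= i < r.+1 * q)%N && u i]|.

Definition layer r v : {set vertex} :=
  [set u : vertex | [forall i : 'I_n, (r * q <= i < r.+1 * q)%N || (u i == v i)]].

Definition below r v : {set vertex} :=
  [set u : vertex | (u != v) && [forall i : 'I_n, (r * q <= i)%N ==> (u i == v i)]].

Lemma ones_upd r v (i : 'I_n) : (r * q <= i < r.+1 * q)%N -> ~~ v i ->
  ones r (upd v i true) = (ones r v).+1.
Proof.
move=> ri vi; rewrite /ones.
have -> : [set j : 'I_n | (r * q <= j < r.+1 * q)%N && upd v i true j] =
    i |: [set j : 'I_n | (r * q <= j < r.+1 * q)%N && v j].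
  by apply/setP => j; rewrite !inE ffunE; case: (eqVneq j i) => [->|]; rewrite ?ri.
by rewrite cardsU1 inE negb_and vi orbT.
Qed.

(** Each step turns on one coordinate of block [r], so at least q - l of them are off before each of
    the [l] steps, and all candidates have the same number of ones. *)
Lemma hypercube_path r v : (r < 4)%N ->
  (forall i : 'I_n, (r * q <= i < r.+1 * q)%N -> v i = false) ->
  growable adj (q - l) l [set v] [set u in layer r v | (ones r v < ones r u)%N].
Proof.
move=> r4 v0; have ones0 : ones r v = 0%N.
  apply/eqP; rewrite cards_eq0; apply/eqP/setP => i; rewrite !inE.
  by apply/negP => /andP[/v0 ->].
pose good j w := w \in layer r v /\ (ones r w + j <= l)%N.
apply: (growable_ranked (good := good) (h := ones r) (g := ones r)) => [j w [wl wj]|].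
  pose F := [set i : 'I_n | (r * q <= i < r.+1 * q)%N && ~~ w i].
  have Fq : (q - l <= #|F|)%N.
    have cP : (#|[set i : 'I_n | (r * q <= i < r.+1 * q)%N]| = q)%N.
      rewrite -[RHS]card_ord; symmetry.
      have h (i : 'I_q) : (r * q + i < n)%N.
        have := ltn_ord i; have : (r * q <= 3 * q)%N by rewrite leq_mul2r -ltnS r4 orbT.
        lia.
      rewrite -(card_imset (f := fun i => Ordinal (h i))) => [|i i' /(congr1 val) /= e]; last first.
        by apply/val_inj/eqP; rewrite -(eqn_add2l (r * q)) e.
      congr #|pred_of_set _|; apply/setP => i; rewrite inE.
      apply/imsetP/idP => [[i' _ ->] /=|/andP[i1 i2]].
        by rewrite leq_addr mulSn addnC ltn_add2r ltn_ord.
      have iq : (i - r * q < q)%N by move: i1 i2; move: (i : nat) => x; rewrite mulSn; lia.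
      by exists (Ordinal iq) => //; apply: val_inj; rewrite /= subnKC.
    apply: (@leq_trans (#|[set i : 'I_n | (r * q <= i < r.+1 * q)%N]| - ones r w)).
      by rewrite cP; apply: leq_sub2l; apply: leq_trans wj; apply: leq_addr.
    rewrite leq_subLR -cardsUI; apply: leq_trans (leq_addr _ _).
    apply: subset_leq_card; apply/subsetP => i; rewrite !inE => ->.
    by case: (w i).
  exists [set upd w i true | i in F]; split.
  - apply/subsetP => _ /imsetP[i iF ->]; rewrite !inE in iF wl *.
    apply/forallP => i'; rewrite ffunE; case: (eqVneq i' i) => [->|_]; last exact: (forallP wl).
    by case/andP: iF => ->.
  - rewrite card_in_imset // => i i' iF _ /upd_inj[] //.
    by move: iF; rewrite inE => /andP[_]; case: (w i).
  - move=> b /imsetP[i]; rewrite inE => /andP[ri wi] {b}->; split.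
    + by apply: differ_in_one_upd; move: wi; case: (w i).
    + by rewrite ones_upd.
    + split; last by rewrite ones_upd // addSn -addnS.
      rewrite !inE in wl *; apply/forallP => i'; rewrite ffunE.
      by case: (eqVneq i' i) => [->|_]; [rewrite ri|exact: (forallP wl)].
  - move=> _ _ /imsetP[i iF ->] /imsetP[i' iF' ->].
    by move: iF iF'; rewrite !inE => /andP[? ?] /andP[? ?]; rewrite !ones_upd.
split; last by rewrite ones0.
by rewrite inE; apply/forallP => i; rewrite eqxx orbT.
Qed.

(* An oriented path has only about n steps, whereas n^3 vertices are needed:
   every vertex of a path in the directions of block r starts its own growth in
   the directions of the lower blocks, in pairwise disjoint fibers. *)
Fixpoint comb_size r := if r is r'.+1 then (l + l * comb_size r')%N else 0%N.

(** Path vertices in block [r] are still 0 in all lower blocks, so the induction applies to them;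
    their coordinates in block [r] keep the fibers apart. *)
Lemma hypercube_comb r v : (r <= 4)%N ->
  (forall i : 'I_n, (i < r * q)%N -> v i = false) ->
  growable adj (q - l) (comb_size r) [set v] (below r v).
Proof.
elim: r v => [|r IH] v r4 v0; first exact: growable0.
pose Y := [set u in layer r v | (ones r v < ones r u)%N].
have YP u : u \in Y -> (forall i : 'I_n, ~~ (r * q <= i < r.+1 * q)%N -> u i = v i)
    /\ exists2 i : 'I_n, (r * q <= i < r.+1 * q)%N & u i != v i.
  rewrite inE => /andP[]; rewrite inE => /forallP ul hu; split.
    by move=> i ri; have := ul i; rewrite (negPf ri) => /eqP.
  apply/exists_inP; apply: contraLR hu; rewrite negb_exists_in => /forall_inP e.
  rewrite -leqNgt; apply: subset_leq_card; apply/subsetP => i; rewrite !inE => /andP[ri].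
  by rewrite ri /=; have := e i ri; rewrite negbK => /eqP ->.
have rq : (r * q <= r.+1 * q)%N by rewrite leq_mul2r leqnSn orbT.
have gY : growable adj (q - l) l [set v] Y.
  by apply: hypercube_path => // i /andP[_]; apply: v0.
apply: growableS (growable_comb (Z := below r) gY _ _ _).
- rewrite subUset; apply/andP; split.
    apply/subsetP => u /YP[ue [i ri ui]]; rewrite inE; apply/andP; split.
      by apply: contraNneq ui => ->.
    apply/forallP => i'; apply/implyP => ri'; apply/eqP/ue.
    by rewrite negb_and -!leqNgt ri' orbT.
  apply/bigcupsP => u /YP[ue [i /andP[ri ri2] ui]]; apply/subsetP => w.
  rewrite !inE => /andP[_ /forallP wu]; apply/andP; split.
    apply: contraNneq ui => <-; have := wu i; rewrite ri /= => /eqP ->; exact: eqxx.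
  apply/forallP => i'; apply/implyP => ri'.
  have := wu i'; rewrite (leq_trans rq ri') /= => /eqP ->; apply/eqP/ue.
  by rewrite negb_and -!leqNgt ri' orbT.
- move=> u u' /YP[ue _] /YP[ue' _] uu'; rewrite -setI_eq0; apply: contraR uu' => /set0Pn[w].
  rewrite !inE => /andP[/andP[_ /forallP h] /andP[_ /forallP h']].
  apply/eqP/ffunP => i; have [ri|ri] := leqP (r * q) i.
    by have := h i; have := h' i; rewrite ri /= => /eqP <- /eqP.
  by rewrite ue ?ue' // negb_and -ltnNge ri.
- move=> u /YP[ue _]; rewrite -setI_eq0; apply/eqP/setP => w; rewrite inE [RHS]inE.
  apply/negP => /andP[/YP[we _]]; rewrite inE => /andP[/eqP wu /forallP h].
  apply: wu; apply/ffunP => i; have [ri|ri] := leqP (r * q) i.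
    by have := h i; rewrite ri /= => /eqP.
  by rewrite ue ?we // negb_and -ltnNge ri.
- move=> u /YP[ue _]; apply: IH; first exact: ltnW.
  move=> i ri; rewrite ue ?v0 //; first exact: leq_trans ri rq.
  by rewrite negb_and -ltnNge ri.
Qed.

Lemma hypercube_attempts mB :
  attempts adj (q - l) (comb_size 4).+1 mB (comb_size 4).+1 (2 ^ k) [set: vertex].
Proof.
pose base (z : {ffun 'I_k -> bool}) : vertex :=
  [ffun i => if split i is inr j then z j else false].
pose Y (z : {ffun 'I_k -> bool}) : {set vertex} :=
  [set u : vertex | [forall j, u (rshift (4 * q) j) == z j]].
have -> : (2 ^ k)%N = (#|{ffun 'I_k -> bool}| * 1)%N.
  by rewrite card_ffun card_ord card_bool muln1.
apply: (attempts_family (Y := Y)).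
  move=> z z' zz'; rewrite -setI_eq0; apply: contraR zz' => /set0Pn[u].
  rewrite !inE => /andP[/forallP h /forallP h'].
  by apply/eqP/ffunP => j; rewrite -(eqP (h j)) (eqP (h' j)).
move=> z; have bz j : base z (rshift (4 * q) j) = z j.
  by rewrite ffunE -[rshift _ j]/(unsplit (inr j)) unsplitK.
have gz : growable adj (q - l) (comb_size 4) [set base z] (below 4 (base z)).
  apply: hypercube_comb => // i i4; rewrite ffunE.
  by case: splitP => // j ij; move: i4; rewrite ij ltnNge leq_addr.
apply: attemptsS (attempts_growable mB _ gz); last by rewrite inE eqxx.
rewrite subUset sub1set inE; apply/andP; split.
  by apply/forallP => j; rewrite bz.
apply/subsetP => u; rewrite !inE => /andP[_ /forallP h]; apply/forallP => j.
by have := h (rshift (4 * q) j); rewrite /= leq_addr bz.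
Qed.

End Hypercube.

Section HypercubeLimit.
Variable R : realType.
Local Open Scope classical_set_scope.

Lemma hypercube_cvg (mu : R) : 64 * (64 * 10) <= mu ->
  AE_solve_prob (@hypercube_adj n) mu @[n --> \oo] --> (1 : R).
Proof.
move=> mu0; have cT n : #|{ffun 'I_n -> bool}| = (2 ^ n)%N.
  by rewrite card_ffun card_ord card_bool.
apply: AE_solve_prob_cvg_nat => //.
  by apply: near_card_ge => n; rewrite cT ltnW // ltn_expl.
have [c cE] : exists c, c = (4 * 32 ^ 3)%N by eexists.
apply: filterS (nbhs_infty_ge (32 * (c + 1))) => n nc.
(* [l] is about n/16, so batches of size q - l have order n, and at least half of the coordinates
   number the disjoint subcubes. Three blocks would give only about l^3 vertices, fewer than 4 n^3;
   with four, n <= 32 l gives 4 n^3 <= c l^3 <= l^4. *)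
pose q := (n %/ 8)%N; pose l := (q %/ 2)%N; pose k := (n - 4 * q)%N.
have q8 : (8 * q <= n < 8 * q + 8)%N.
  by rewrite /q mulnC leq_trunc_div /= {1}(divn_eq n 8) ltn_add2l ltn_mod.
have l2 : (2 * l <= q < 2 * l + 2)%N.
  by rewrite /l mulnC leq_trunc_div /= {1}(divn_eq q 2) ltn_add2l ltn_mod.
have nc' : (32 * c + 32 <= n)%N by move: nc; rewrite /= mulnDr muln1.
have nl : (n <= 32 * l)%N by lia.
have cl : (c <= l)%N by lia.
have nk : (4 * q + k = n)%N by rewrite /k; lia.
have Kl : (4 * n ^ 3 <= (comb_size l 4).+1)%N.
  apply: (@leq_trans (4 * (32 * l) ^ 3)); first by rewrite leq_mul2l leq_exp2r.
  rewrite expnMn mulnA -cE; apply: (@leq_trans (l * l ^ 3)); first by rewrite leq_mul2r cl orbT.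
  by rewrite !expnS expn0 /=; move: (l) => x; nia.
exists n, (q - l)%N, (comb_size l 4).+1, 2%N, (comb_size l 4).+1, (2 ^ k)%N, 1%N, n.
rewrite cT muln1; split.
- by split; [apply: hypercube_max_degree; lia|lia].
- by rewrite leqnn subnn.
- by split=> //; rewrite -expnM leq_pexp2l //; lia.
- move: Kl; rewrite !expnS expn0; move: (comb_size l 4).+1 => x.
  rewrite !muln1 => h; split; nia.
split; first exact: differ_in_one_connected.
by rewrite -nk; apply: hypercube_attempts.
Qed.

End HypercubeLimit.

(** * The Hamming graph *)

Section Hamming.
Variables (d1 d2 n : nat).
Hypothesis d1_gt1 : (1 < d1)%N.
Local Notation vertex := {ffun 'I_(d1 + d2) -> 'I_n}.
Local Notation adj := (@hamming_adj (d1 + d2) n).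
Local Notation act i := (@lshift d1 d2 i).
Implicit Types (u v w : vertex) (A : {set 'I_n}) (X W : {set vertex}).

Variables (reserve : {set 'I_n}) (c mB s K1 : nat) (z : {ffun 'I_d2 -> 'I_n}).
Hypothesis reserve_blocks : (s * mB <= #|reserve|)%N.
Hypothesis K1_gt0 : (0 < K1)%N.
Let K := (K1 + (s + s * s))%N.

Definition fiber : {set vertex} := [set u : vertex | [forall j, u (rshift d1 j) == z j]].

Lemma fiber_upd v i a : (upd v (act i) a \in fiber) = (v \in fiber).
Proof.
by rewrite !inE; apply: eq_forallb => j; rewrite ffunE eq_rlshift.
Qed.

(* A is the set of coordinate values used so far. Each step changes a coordinate,
   other than the one just changed, to an unused value; hence a tested vertex
   has at most one unused active coordinate, and a vertex with two unused active
   coordinates is fresh. The values in reserve are kept for the last stage. *)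
Definition fresh X A : Prop := reserve \subset A /\
  forall u, u \in fiber -> u \notin X ->
    (forall i j : 'I_d1, i != j -> u (act i) \in A \/ u (act j) \in A) /\
    (forall i : 'I_d1, u (act i) \notin reserve).

Lemma hamming_star v i l (E : {set 'I_n}) : v i \notin E -> (l * mB <= #|E|)%N ->
  growable adj mB l [set v] [set upd v i a | a in E].
Proof.
move=> vE lE; apply: growable_star.
  move=> _ /imsetP[a aE ->]; apply: differ_in_one_upd.
  by apply: contraNneq vE => <-.
rewrite card_in_imset // => a a' aE _ /upd_inj[] //.
by apply: contraNneq vE => <-.
Qed.

(* The last stage uses the reserved values only: first s new vertices on one line
   through v, then s more on a line through each of them. *)
Lemma hamming_extendable X A W v : fresh X A -> [disjoint X & W] ->
  v \in W -> v \in fiber -> (forall i : 'I_d1, v (act i) \notin reserve) ->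
  extendable adj K1 mB K X W.
Proof.
move=> [_ fX] dXW vW vz vR; rewrite /extendable /K addKn.
pose i0 := act (Ordinal (ltnW d1_gt1)); pose i1 := act (Ordinal d1_gt1).
have i10 : i1 != i0 by [].
pose Z u := [set upd u i1 a | a in reserve].
pose Y := [set upd v i0 a | a in reserve].
have Yi1 u : u \in Y -> u i1 = v i1.
  by case/imsetP => a _ ->; rewrite ffunE (negPf i10).
have inX u : u \in fiber -> (exists i, u (act i) \in reserve) -> u \in X.
  move=> uz [i ui]; apply: contraLR ui => uX; exact: (fX u uz uX).2.
have g : growable adj mB (s + s * s) [set v] (Y :|: \bigcup_(u in Y) Z u).
  apply: growable_comb.
  - by apply: hamming_star => //; apply: vR.
  - move=> u u' /imsetP[a _ uE] /imsetP[a' _ uE'] uu'.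
    rewrite -setI_eq0; apply: contraR uu' => /set0Pn[w]; rewrite inE.
    case/andP => /imsetP[b _ e] /imsetP[b' _ e'].
    have : w i0 = w i0 by []; rewrite {1}e e' !ffunE eq_sym (negPf i10) uE uE' !ffunE eqxx.
    by move=> ->.
  - move=> u uY; rewrite -setI_eq0; apply/eqP/setP => w; rewrite inE [RHS]inE.
    apply/negP => /andP[/Yi1 wv /imsetP[b bR e]].
    by have := vR (Ordinal d1_gt1); rewrite -/i1 -wv e ffunE eqxx bR.
  - by move=> u uY; apply: hamming_star => //; rewrite Yi1 //; apply: vR.
apply: g => //; first by rewrite sub1set.
rewrite subUset; apply/andP; split.
  apply/subsetP => u /imsetP[a aR ->]; apply: inX; first by rewrite fiber_upd.
  by exists (Ordinal (ltnW d1_gt1)); rewrite ffunE eqxx.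
apply/bigcupsP => u /imsetP[a aR ->]; apply/subsetP => w /imsetP[b bR ->].
apply: inX; first by rewrite !fiber_upd.
by exists (Ordinal d1_gt1); rewrite ffunE eqxx.
Qed.

Lemma hamming_run Q j X A W v i0 :
  fresh X A -> [disjoint X & W] -> v \in W -> v \in fiber ->
  (forall i : 'I_d1, v (act i) \in A) ->
  (forall i : 'I_d1, v (act i) \notin reserve) ->
  (forall (i : 'I_d1) a, i != i0 -> a \notin A -> upd v (act i) a \in X) ->
  (#|A| + j + c <= n)%N ->
  (forall X' A', fresh X' A' -> (#|A'| <= #|A| + j)%N -> Q X') ->
  grow adj (d1.-1 * c) Q (extendable adj K1 mB K) j X W.
Proof.
elim: j X A W v i0 => [|j IH] X A W v i0 fX dXW vW vz vA vR vX cA QA /=.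
  exact: (hamming_extendable fX dXW vW).
case: (fX) => sRA fX2.
pose P := [set p : 'I_d1 * 'I_n | (p.1 != i0) && (p.2 \notin A)].
pose b (p : 'I_d1 * 'I_n) := upd v (act p.1) p.2.
pose B := [set b p | p in P].
have vne i a : a \notin A -> a != v (act i).
  by move=> aA; apply: contraNneq aA => ->.
(* A newly tested vertex differs from [v] in one coordinate only, so at most one of its active
   coordinates is outside [A]. *)
have fB : fresh (X :\: B) A.
  split=> // u uz; rewrite inE negb_and negbK => /orP[|/fX2 h]; last exact: h.
  case/imsetP => -[i a]; rewrite inE => /andP[/= ii0 aA] ->; split=> [k k' kk'|k].
    rewrite !ffunE !eq_lshift.
    case: (eqVneq k i) => [ki|_]; last by left; apply: vA.
    by right; rewrite -ki eq_sym (negPf kk'); apply: vA.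
  rewrite ffunE; case: eqVneq => [_|_]; last exact: vR.
  by apply: contraNN aA; apply: (subsetP sRA).
exists B; split.
- apply/subsetP => u /imsetP[[i a]]; rewrite inE => /andP[/= ii0 aA] ->.
  exact: vX.
- rewrite card_in_imset => [|[i a] [i' a']]; last first.
    rewrite !inE => /andP[/= _ aA] _ /upd_inj[]; first exact: vne.
    by move=> /= /lshift_inj -> ->.
  have -> : P = setX [set~ i0] (~: A) by apply/setP => p; rewrite !inE.
  rewrite cardsX cardsC1 card_ord; apply: leq_mul => //.
  by rewrite cardsCs setCK card_ord; move: cA; move: #|A| => y; lia.
- by apply: (QA _ A) => //; apply: leq_addr.
move=> _ /imsetP[[i a] pP ->]; move: (pP); rewrite inE => /andP[/= ii0 aA].
split; first by exists v => //; apply: differ_in_one_upd; apply: vne.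
have bX : b (i, a) \in X by apply: vX.
have cA1 : #|a |: A| = #|A|.+1 by rewrite cardsU1 aA.
apply: (IH _ (a |: A) _ (b (i, a)) i).
- split; first by apply: subset_trans sRA _; apply: subsetUr.
  move=> u uz /(fB.2 u uz)[h1 h2]; split=> // k k' /h1[h|h]; [left|right];
    by rewrite inE h orbT.
- rewrite disjoint_sym disjoints_subset subUset sub1set !inE imset_f //=.
  rewrite -disjoints_subset disjoint_sym; apply: disjointWl dXW; exact: subsetDl.
- by rewrite !inE eqxx.
- by rewrite fiber_upd.
- move=> k; rewrite !inE ffunE; case: (act k == act i); rewrite ?eqxx //.
  by rewrite vA orbT.
- move=> k; rewrite ffunE; case: (act k == act i); last exact: vR.
  by apply: contraNN aA; apply: (subsetP sRA).
- move=> k a' ki; rewrite !inE negb_or => /andP[a'a a'A].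
  have h : ~ ((upd (b (i, a)) (act k) a') (act k) \in A \/
              (upd (b (i, a)) (act k) a') (act i) \in A).
    rewrite !ffunE eqxx eq_lshift [i == k]eq_sym (negPf ki) eqxx.
    by rewrite (negPf a'A) (negPf aA); case.
  have uz : upd (b (i, a)) (act k) a' \in fiber by rewrite !fiber_upd.
  rewrite -[_ && _]negbK negb_and negbK; apply/negP => /orP[/imsetP[[i' a''] ]|uX].
    rewrite inE /= => /andP[i'i0 a''A] e; apply: h; rewrite e !ffunE.
    rewrite !eq_lshift.
    by case: (eqVneq k i') => [<-|_]; [right|left]; rewrite ?vA // eq_sym (negPf ki) vA.
  exact: (h ((fX2 _ uz uX).1 k i ki)).
- by rewrite cA1; move: cA; lia.
- by move=> X' A' fX'; rewrite cA1 addSn -addnS => /(QA _ _ fX').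
Qed.

Lemma hamming_fiber_attempts M X A :
  fresh X A -> (#|A| + M * K1 + c <= n)%N ->
  attempts adj (d1.-1 * c) K1 mB K M X.
Proof.
elim: M X A => // M IH X A fX cA; have [sRA fX2] := fX.
have [x xA] : exists x, x \notin A.
  apply/existsP; rewrite -negb_forall; apply/negP => /forallP h.
  have : #|A| = n by rewrite -[RHS]card_ord; apply/eq_card => x; rewrite h inE.
  by move: cA; rewrite mulSn; lia.
pose v : vertex := [ffun i => if split i is inr j then z j else x].
have vact i : v (act i) = x by rewrite ffunE -[lshift _ i]/(unsplit (inl i)) unsplitK.
have vz : v \in fiber.
  rewrite inE; apply/forallP => j.
  by rewrite ffunE -[rshift _ j]/(unsplit (inr j)) unsplitK.
have inX u i j : u \in fiber -> i != j -> u (act i) \notin A -> u (act j) \notin A -> u \in X.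
  move=> uz ij ui uj; apply: contraT => uX.
  by have [h _] := fX2 u uz uX; have [] := h i j ij; [rewrite (negPf ui)|rewrite (negPf uj)].
pose j0 := Ordinal (ltnW d1_gt1); pose j1 := Ordinal d1_gt1.
have vX : v \in X by apply: (inX v j0 j1) => //; rewrite vact.
have xR : x \notin reserve by apply: contraNN xA; apply: (subsetP sRA).
have cA1 : #|x |: A| = #|A|.+1 by rewrite cardsU1 xA.
exists v => //; apply: (hamming_run (A := x |: A) (v := v) (i0 := j0)).
- split; first by apply: subset_trans sRA _; apply: subsetUr.
  move=> u uz; rewrite !inE negb_and negbK => /orP[/eqP ->|uX].
    by split=> [i j _|i]; rewrite vact // !inE eqxx; left.
  have [h1 h2] := fX2 u uz uX; split=> // i j /h1[h|h]; [left|right];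
    by rewrite inE h orbT.
- by rewrite disjoint_sym disjoints1 !inE eqxx.
- by rewrite inE.
- exact: vz.
- by move=> i; rewrite vact !inE eqxx.
- by move=> i; rewrite vact.
- move=> i a _; rewrite !inE negb_or => /andP[ax aA]; apply/andP; split.
    apply: contraNneq ax => /ffunP/(_ (act i)); rewrite vact ffunE eqxx => ->; exact: eqxx.
  have [j ij] : exists j, i != j.
    by have [->|h] := eqVneq i j0; [exists j1|exists j0].
  apply: (inX _ i j) => //; first by rewrite fiber_upd.
    by rewrite ffunE eqxx.
  by rewrite ffunE eq_lshift eq_sym (negPf ij) vact.
- by rewrite cA1; move: cA K1_gt0; rewrite mulSn; lia.
move=> X' A' fX'; rewrite cA1 => cA'.
apply: (IH X' A') => //; move: cA cA' K1_gt0; rewrite mulSn; move: (M * K1)%N => y.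
by move: #|A| #|A'| => a a'; lia.
Qed.

End Hamming.

(** The [n] coordinate values limit the attempts inside one fiber, whereas the number required is a
    power of [n] growing with [d]; the last [d2] coordinates therefore index disjoint fibers.
    Initially the reserved values count as used. *)
Lemma hamming_attempts d1 d2 n c mB s K1 M : (1 < d1)%N -> (s * mB <= c)%N ->
  (0 < K1)%N -> (c + M * K1 + c <= n)%N ->
  attempts (@hamming_adj (d1 + d2) n) (d1.-1 * c) K1 mB (K1 + (s + s * s))
    (n ^ d2 * M) [set: {ffun 'I_(d1 + d2) -> 'I_n}].
Proof.
move=> d1_gt1 sc K0 cn.
pose Rv := [set x : 'I_n | (x < c)%N].
have cR : #|Rv| = c.
  have c_n : (c <= n)%N by apply: leq_trans cn; rewrite leq_addl.
  have inj : injective (widen_ord c_n).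
    by move=> x y /(congr1 val) /= e; apply: val_inj.
  rewrite -[RHS](card_ord c) -(card_imset _ inj).
  apply: eq_card => x; rewrite inE; apply/idP/imsetP => [xc|[y _ ->]].
    by exists (Ordinal xc) => //; apply: val_inj.
  exact: (ltn_ord y).
have -> : (n ^ d2 = #|{ffun 'I_d2 -> 'I_n}|)%N by rewrite card_ffun !card_ord.
apply: (attempts_family (Y := @fiber d1 d2 n)).
  move=> z z' zz'; rewrite -setI_eq0; apply: contraR zz' => /set0Pn[u].
  rewrite !inE => /andP[/forallP h /forallP h'].
  by apply/eqP/ffunP => j; rewrite -(eqP (h j)) (eqP (h' j)).
move=> z; apply: (@hamming_fiber_attempts d1 d2 n d1_gt1 Rv c mB s K1 z _ K0 M _ Rv).
- by rewrite cR.
- by split => // u uz; rewrite uz.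
- by rewrite cR.
Qed.

Lemma hamming_max_degree d n : (0 < d)%N -> (1 < n)%N ->
  (0 < max_degree (@hamming_adj d n) <= d * n)%N.
Proof.
move=> d0 n1; apply/andP; split.
  pose x0 := Ordinal (ltnW n1); pose x1 := Ordinal n1.
  apply: (@max_degree_gt0 _ _ (upd [ffun=> x0] (Ordinal d0) x1) [ffun=> x0]).
  by apply: differ_in_one_upd; rewrite ffunE.
have -> : (d * n)%N = #|{: 'I_d * 'I_n}| by rewrite card_prod !card_ord.
apply: (max_degree_bounds (f := fun (v : {ffun 'I_d -> 'I_n}) p => upd v p.1 p.2)).
by move=> v w /differ_in_oneP[i e]; exists (i, w i).
Qed.

Section HammingLimit.
Variable R : realType.
Local Open Scope classical_set_scope.

Lemma hamming_cvg (d : nat) (mu : R) : (1 < d)%N -> 64 * (64 * 10) <= mu ->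
  AE_solve_prob (@hamming_adj d n) mu @[n --> \oo] --> (1 : R).
Proof.
move=> d_gt1 mu0; have cT n : #|{ffun 'I_d -> 'I_n}| = (n ^ d)%N.
  by rewrite card_ffun !card_ord.
have d0 : (0 < d)%N by apply: ltnW.
apply: AE_solve_prob_cvg_nat => //.
  by apply: near_card_ge => n; rewrite cT; case: n => // n; rewrite -{1}(expn1 n.+1) leq_pexp2l.
have [b bE] : exists b, b = (16 ^ 2)%N by eexists.
have [a aE] : exists a, a = (2 ^ 16)%N by eexists.
apply: filterS (near_root (6 * d * (b * d ^ 2) * a + 8) (ltn0Sn 15)) => n [Q [Q0 Qn nQ]].
pose d2 := (d.-1 %/ 2)%N; pose d1 := (d - d2)%N; pose c := (n %/ 4)%N.
have dE : (2 * d2 <= d.-1 < 2 * d2 + 2)%N.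
  by rewrite /d2 mulnC leq_trunc_div /= {1}(divn_eq d.-1 2) ltn_add2l ltn_mod.
have cE : (4 * c <= n < 4 * c + 4)%N.
  by rewrite /c mulnC leq_trunc_div /= {1}(divn_eq n 4) ltn_add2l ltn_mod.
have d12 : (d1 + d2 = d)%N by rewrite /d1; lia.
have d1_gt1 : (1 < d1)%N by rewrite /d1; lia.
have d1d : (d <= 3 * d1.-1)%N by rewrite /d1; lia.
have Q8 : (8 <= Q)%N by apply: leq_trans Q0; rewrite leq_addl.
have Q00 : (0 < Q)%N by lia.
have Qpow i j : (i <= j)%N -> (Q ^ i <= Q ^ j)%N by move=> ij; rewrite leq_pexp2l.
have Qn' : (8 * Q ^ 15 <= n)%N by apply: leq_trans Qn; rewrite (expnS Q 15) leq_mul2r Q8 orbT.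
have n8 : (8 <= n)%N.
  by apply: leq_trans Qn'; apply: leq_pmulr; rewrite expn_gt0 Q00.
have Q15c : (Q ^ 15 <= c)%N by move: Qn' cE; move: (Q ^ 15)%N => x; lia.
have naQ : (n <= a * Q ^ 16)%N.
  by apply: leq_trans (ltnW nQ) _; rewrite aE -expnMn leq_exp2r //; lia.
have nQ32 : (n <= Q ^ 32)%N.
  apply: leq_trans (ltnW nQ) _; rewrite -[32%N]/(2 * 16)%N expnM leq_exp2r //.
  by rewrite -mulnn; nia.
have main : (6 * (d * n) * (16 * d * Q) ^ 2 <= Q ^ 19)%N.
  have -> : (6 * (d * n) * (16 * d * Q) ^ 2 = (6 * d * (b * d ^ 2)) * (n * Q ^ 2))%N.
    by rewrite bE !expnMn; ring.
  apply: (@leq_trans (6 * d * (b * d ^ 2) * (a * Q ^ 16 * Q ^ 2))).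
    by rewrite leq_mul2l leq_mul2r naQ !orbT.
  have -> : (a * Q ^ 16 * Q ^ 2 = a * Q ^ 18)%N by rewrite -mulnA -expnD.
  rewrite mulnA (expnS Q 18) leq_mul2r; apply/orP; right.
  by apply: leq_trans Q0; apply: leq_addr.
have nc : (n <= 8 * c)%N by move: cE n8; clear; lia.
clear aE bE naQ Q0.
(* Q attempts of Q^14 steps use Q^15 values, at most n/8. The second stage adds more than Q^20
   vertices, enough since 4 D (log N)^2 <= Q^19; its batches of Q^5 give K1 mB = Q^19, and each of
   its lines needs Q^15 reserved values. *)
exists (d * n)%N, (d1.-1 * c)%N, (Q ^ 14)%N, (Q ^ 5)%N,
  (Q ^ 14 + (Q ^ 10 + Q ^ 10 * Q ^ 10))%N, (n ^ d2 * Q)%N, Q, (16 * d)%N.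
rewrite cT; split.
- split; first by apply: hamming_max_degree => //; apply: leq_trans n8.
  apply: leq_trans (leq_mul d1d nc) _.
  by rewrite mulnACA leq_mul2r orbT.
- rewrite expn_gt0 Q00 leq_addr addKn; split=> //.
  apply: (@leq_trans (n ^ 2)); last by rewrite leq_pexp2l //; clear -d_gt1 n8; lia.
  apply: (@leq_trans ((2 * Q ^ 15) ^ 2)); last first.
    by rewrite leq_exp2r //; apply: leq_trans Qn'; rewrite leq_mul2r orbT.
  rewrite -expnD expnMn -expnM.
  have h1 : (Q ^ 10 <= Q ^ 30)%N by apply: Qpow.
  have h2 : (Q ^ 20 <= Q ^ 30)%N by apply: Qpow.
  by move: h1 h2; move: (Q ^ 10)%N (Q ^ 20)%N (Q ^ 30)%N => x y t; clear; lia.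
- split; first by rewrite expnM leq_exp2r // ltnW.
  (* The fibers account for n^(64 d2), and the [Q] attempts in each for the remaining n^2 <=
     Q^64. *)
  apply: (@leq_trans (n ^ (d2 * 64) * n ^ 2)).
    by rewrite -expnD leq_pexp2l //; clear -dE n8; lia.
  rewrite expnMn -expnM leq_mul2l; apply/orP; right.
  have nQ' : (n ^ 2 <= (Q ^ 32) ^ 2)%N by rewrite leq_exp2r.
  by apply: leq_trans nQ' _; rewrite -expnM.
- split; last by rewrite -expnD.
  apply: (@leq_trans (Q ^ 19)).
    by apply: leq_trans main; rewrite !leq_mul2r; apply/orP; right; apply/orP; right.
  apply: (@leq_trans (Q ^ 20)); first exact: Qpow.
  by rewrite -expnD !addnA leq_addl.
split; first exact: differ_in_one_connected.
have h : (c + Q * Q ^ 14 + c <= n)%N.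
  by rewrite -expnS; move: cE Qn'; move: (Q ^ 15)%N => x; clear; lia.
have := @hamming_attempts d1 d2 n c (Q ^ 5) (Q ^ 10) (Q ^ 14) Q d1_gt1 _ _ h.
by rewrite d12 -expnD expn_gt0 Q00; apply.
Qed.

End HammingLimit.

Local Open Scope classical_set_scope.

Theorem theorem2 (R : realType) :
  exists C : R, forall mu : R, C <= mu ->
  [/\ (forall d : nat, (1 <= d)%N ->
         AE_solve_prob (@torus_adj d n) mu @[n --> \oo] --> (1 : R)),
      (forall r : nat, (1 <= r)%N ->
         AE_solve_prob (@range_adj r n) mu @[n --> \oo] --> (1 : R)),
      AE_solve_prob (@hypercube_adj n) mu @[n --> \oo] --> (1 : R)
    & (forall d : nat, (2 <= d)%N ->
         AE_solve_prob (@hamming_adj d n) mu @[n --> \oo] --> (1 : R))].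
Proof.
(* A factor 2 is lost to sprinkling and 32 to batches smaller than the degree; the remaining 640
   makes a run succeed with probability at least of order N^(-1/128), against N^(1/64) attempts. *)
exists (64 * (64 * 10)) => mu mu0; split.
- by move=> d d0; apply: torus_cvg.
- by move=> r r0; apply: range_cvg.
- exact: hypercube_cvg.
- by move=> d d1; apply: hamming_cvg.
Qed.
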